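(* Let $A:[1,\infty)\to(0,\infty)$ be a non-decreasing $C^1$-function and suppose $f\in\mathcal C_A([0,1])$, with Bang degree $\mathfrak n_f$. Then for any interval $I\subset[0,1]$ and any measurable subset $E\subset I$, $$\|f\|_I\le\left(\frac{\Gamma(2\mathfrak n_f)\,|I|}{|E|}\right)^{2\mathfrak n_f}\|f\|_E .$$
   Context: $\|f\|_K=\sup_K|f|$ denotes the supremum norm on $K$, and $|E|$ is the length (Lebesgue measure) of a set $E\subset\mathbb R$. Given a non-decreasing function $A:[1,\infty)\to(0,\infty)$, define $M_0=1$ and $M_j=M_{j-1}A(j)$ for $j\ge1$ (so $\{M_j\}$ is logarithmically convex). $\mathcal C_A([0,1])$ is the class of functions $f\in C^\infty([0,1])$ with $\|f^{(j)}\|_{[0,1]}\le M_j$ for all integers $j\ge0$. The Bang degree $\mathfrak n_f$ of $f\in\mathcal C_A([0,1])$ is the largest integer $N$ such that $$\sum_{\log\|f\|_{[0,1]}^{-1}<j\le N}\frac{M_{j-1}}{M_j}<e,$$ where the sum is over integers $j$; if the set of positive integers $N$ satisfying this inequality is unbounded, then one sets formally $\mathfrak n_f=+\infty$. The function $A$ defining the sequence $\{M_j\}$ is assumed to be $C^1$ (if $A$ is piecewise linear, one can use the left derivative), and one sets $$\gamma(n)=\sup_{1\le s\le n}\frac{sA'(s)}{A(s)},\qquad \Gamma(n)=4e^{4+\gamma(n)}.$$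
   Formalization: The Bang degree is assumed finite and at least 1 (for degree 0, Γ(0) is a supremum over an empty set and the bound ‖f‖_I ≤ ‖f‖_E fails, e.g. A=1/10, f=1/2+x/10, E=[0,1/2]), and |E|>0 is assumed since the bound divides by |E|. *)

(* Defs.v *)
From HB Require Import structures.
From mathcomp Require Import all_boot all_order all_algebra.
From mathcomp Require Import all_classical all_reals all_analysis.

Set Implicit Arguments.
Unset Strict Implicit.
Unset Printing Implicit Defensive.

Import Order.TTheory GRing.Theory Num.Theory.
Import numFieldNormedType.Exports.

Local Open Scope classical_set_scope.
Local Open Scope ring_scope.

Section RelativeDerivative.
Variable R : realType.
Implicit Types (D : set R) (f : R -> R).

(* Difference quotients are taken at points of D only, so that derivatives at
   an endpoint of an interval D are one-sided and the values of f outside D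
   are irrelevant. *)
Definition derivable_on D f : Prop := forall x, D x ->
  cvg ((f y - f x) / (y - x) @[y --> within D x^']).

Definition derive_on D f : R -> R := fun x =>
  lim ((f y - f x) / (y - x) @[y --> within D x^']).

Definition deriven_on D (j : nat) f : R -> R := iter j (derive_on D) f.

Definition smooth_on D f : Prop :=
  forall j, derivable_on D (deriven_on D j f).

Definition C1_on D f : Prop :=
  derivable_on D f /\ {within D, continuous (derive_on D f)}.

(* Only used for nonempty K and f bounded on K: sup is 0 otherwise. *)
Definition supnorm (K : set R) f : R := sup [set `|f x| | x in K].

End RelativeDerivative.

Section BangDegree.
Variable R : realType.
Implicit Types (A f : R -> R).

Fixpoint M A (j : nat) : R :=
  if j is i.+1 then M A i * A j%:R else 1.

Definition class_C A : set (R -> R) := [set f |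
  smooth_on `[0, 1] f /\
  forall j, supnorm `[0, 1] (deriven_on `[0, 1] j f) <= M A j].

(* The lower summation bound is computed in the extended reals, so that for
   f = 0 on [0, 1] it is +oo and all the sums are empty.  Starting at j = 1
   loses nothing: the norm of f is at most M_0 = 1, so the bound is >= 0. *)
Definition bang_sum A f (N : nat) : R :=
  \sum_(1 <= j < N.+1 | (lne ((supnorm `[0, 1] f)%:E^-1) < j%:R%:E)%E)
    M A j.-1 / M A j.

(* The set of admissible N contains 0, so this supremum is its largest element
   if the set is bounded, and +oo otherwise. *)
Definition bang_degree A f : \bar R :=
  ereal_sup [set (N%:R)%:E | N in [set N : nat | bang_sum A f N < expR 1]].

(* For n < 1 the supremum is over the empty set and has no meaning. *)
Definition gamma A (n : R) : R :=
  sup [set s * derive_on `[1, +oo[ A s / A s | s in `[1, n]].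

Definition Gamma A (n : R) : R := 4 * expR (4 + gamma A n).

End BangDegree.

Section Length.
Variable R : realType.

(* All Lebesgue measurable sets, not only the Borel ones. *)
Definition lebesgue_measurable (E : set R) : Prop :=
  ((@wlength R idfun)^*%mu).-cara.-measurable E.

Definition length (E : set R) : R := fine (completed_lebesgue_measure E).

End Length.

(* Main.v *)
Require Import Defs.
From HB Require Import structures.
From mathcomp Require Import all_boot all_order all_algebra.
From mathcomp Require Import all_classical all_reals all_analysis.
From mathcomp Require Import ring lra zify.

Set Implicit Arguments.
Unset Strict Implicit.
Unset Printing Implicit Defensive.

Import Order.TTheory GRing.Theory Num.Theory.
Import numFieldNormedType.Exports.

Local Open Scope classical_set_scope.
Local Open Scope ring_scope.

(** Write g_j = f^(j) / M_j.  Then |g_j| <= 1 and |g_j'| <= A(j+1) |g_(j+1)|.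
    Suppose that a point moves in one direction, meets points xi_n, ..., xi_0
    in this order, and that g_j is tiny at xi_j.  Bang's idea is that such
    smallness is lost slowly: g_j can only grow after g_(j+1) has grown, and
    g_(j+1) is never larger than 1.  Descending induction on j
    ([bang_propagation]) turns this into
      |g_j| <= exp (e A(j+1) (t - S_(j+1)) - 1) after travelling a length t,
    where S_j is the sum of 1 / (e A(i)) over j <= i <= n+1.

    Let k be the integer part of -log of the norm of f on [0, 1], so that some X
    has |f X| > e^-(k+1).  As n+1 exceeds the Bang degree, the sum of 1 / A(i)
    over k < i <= n+1 is at least e.  Replacing A(i) by A(k+1) for i <= k, and
    since a motion in [0, 1] has length t <= 1, the estimate above for j = 0
    gives |f X| <= e^-(k+1) for every motion that ends at X.  Hence no such
    motion exists, i.e. the values g_j (xi_j) cannot all be tiny.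

    To use this, choose n+1 nodes in the part of E on one side of X, of length
    at least |E|/2, at mutual distances at least |E| / (2(n+1))
    ([separated_points]); let P be the Lagrange interpolant of f at these
    nodes.  Rolle's theorem gives the points xi_j, in the right order, with
    f^(j) = P^(j) at xi_j ([rolle_chain]), and P^(j) is bounded by an explicit
    multiple of the norm of f on E ([interp_deriv_le]).  With s = |I| the
    outcome is [set_norm_lower_bound]: for some j <= n,
      M_(j+1) / A(2n) (s/n)^j <= e^(2n+5) (4 s / |E|)^n eta,
    where eta is the norm of f on E.

    If s A(2n) >= n, the index gamma(2n) prevents A(1), ..., A(2n) from being
    much smaller than A(2n), so that the left-hand side is at least
    e^(-2n gamma(2n)) ([weight_ge]), and it remains to use |f| <= 1.  If
    s A(2n) < n, then on I the function f differs from an interpolant at n+1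
    nodes of E by at most M_(n+1) s^(n+1) / (n+1)!, which is at most e^n times
    the left-hand side ([remainder_le_weight]), while the interpolant itself is
    controlled by its nodal values.  In both cases the powers of e that are
    lost fit into Gamma(2n)^(2n). *)

(** * Functions dominated through their derivatives *)

Section Domination.
Variable R : realType.
Implicit Types (phi dphi H dH : R -> R).

(** A form of the mean value theorem: both H - phi and H + phi are
    nondecreasing. *)
Lemma ler_dist_dominated phi dphi H dH (a b : R) : a <= b ->
  (forall x : R, a < x < b -> is_derive x 1 phi (dphi x)) ->
  {within `[a, b], continuous phi} ->
  (forall x : R, is_derive x 1 H (dH x)) ->
  (forall x, a < x < b -> `|dphi x| <= dH x) ->
  `|phi b - phi a| <= H b - H a.
Proof.
rewrite le_eqVlt => /predU1P[->|ab] dphiP cphi dHP le_d.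
  by rewrite !subrr normr0.
have cH : {within `[a, b], continuous H}.
  apply: derivable_within_continuous => x _.
  by case: (dHP x).
have dP (s x : R) : x \in `]a, b[%R ->
    is_derive x 1 (H + s \*: phi) (dH x + s *: dphi x).
  rewrite in_itv/= => xab; have := dphiP x xab; have := dHP x => ? ?.
  exact: is_deriveD.
have cP (s : R) : {within `[a, b], continuous (H + s \*: phi)}.
  move=> x; apply: continuousD; first exact: cH.
  by apply: continuousZl_tmp; exact: cphi.
rewrite ler_norml; apply/andP; split.
  have [c cab] := MVT ab (dP 1) (cP 1).
  move: (cab); rewrite in_itv/= => cab'.
  rewrite /= !fctE/= !scale1r => e.
  have : 0 <= (dH c + dphi c) * (b - a).
    rewrite mulr_ge0 ?subr_ge0 ?(ltW ab)//.
    by have := le_d c cab'; rewrite ler_norml; lra.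
  by rewrite -e; lra.
have [c cab] := MVT ab (dP (-1)) (cP (-1)).
move: (cab); rewrite in_itv/= => cab'.
rewrite /= !fctE/= !scaleN1r => e.
have : 0 <= (dH c - dphi c) * (b - a).
  rewrite mulr_ge0 ?subr_ge0 ?(ltW ab)//.
  by have := le_d c cab'; rewrite ler_norml; lra.
by rewrite -e; lra.
Qed.

(** The derivative of phi is at most dH as long as this is useful, and at most
    B later on: phi follows H up to s, and then a line of slope B.  The initial
    bound is by the smallest value H c, so that it is still available when the
    motion starts after s. *)
Lemma capped_growth phi dphi H dH (B c p q s x : R) :
  0 <= B -> c <= p -> c <= s -> p <= x <= q ->
  (forall y : R, p < y < q -> is_derive y 1 phi (dphi y)) ->
  {within `[p, q], continuous phi} ->
  (forall y : R, is_derive y 1 H (dH y)) ->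
  (forall y, c <= y -> H c <= H y) ->
  (forall y, p < y < q -> `|dphi y| <= dH y) ->
  (forall y, p < y < q -> `|dphi y| <= B) ->
  `|phi p| <= H c ->
  (x <= s -> `|phi x| <= H x) /\ (s <= x -> `|phi x| <= H s + B * (x - s)).
Proof.
move=> B_ge0 cp cs /andP[px xq] dphiP cphi dHP H_ge le_dH le_B phip.
have sub u v : p <= u -> v <= q -> {within `[u, v], continuous phi}.
  move=> pu vq; apply: continuous_subspaceW cphi => y/=; rewrite !in_itv/=;
    lra.
have toH u : p <= u <= q -> `|phi u| <= H u.
  move=> /andP[pu uq].
  have : `|phi u - phi p| <= H u - H p.
    apply: (ler_dist_dominated pu _ (sub _ _ (lexx _) uq) dHP) => y yu.
      by apply: dphiP; lra.
    by apply: le_dH; lra.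
  by have := H_ge p cp; have := ler_normD (phi u - phi p) (phi p);
    rewrite subrK; lra.
have byB u v : p <= u -> u <= v -> v <= q ->
  `|phi v| <= `|phi u| + B * (v - u).
  move=> pu uv vq.
  have dB (y : R) : is_derive y 1 (fun z : R => B * z) B.
    have := @is_deriveZ R R R id B y 1 1 (is_derive_id _ _).
    by rewrite [B *: 1]mulr1.
  have : `|phi v - phi u| <= B * v - B * u.
    apply: (ler_dist_dominated uv _ (sub _ _ pu vq) dB) => y yu.
      by apply: dphiP; lra.
    by apply: le_B; lra.
  by have := ler_normD (phi v - phi u) (phi u); rewrite subrK; lra.
split=> [xs|sx]; first by apply: toH; rewrite px.
have [ps|sp] := leP p s.
  have := byB s x ps sx xq; have := toH s;
    rewrite ps (le_trans sx xq) => /(_ isT); lra.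
have := byB p x (lexx _) px xq; have := H_ge s cs.
have : 0 <= B * (p - s) by rewrite mulr_ge0//; lra.
lra.
Qed.

End Domination.

(** * Propagation of smallness along a chain of derivatives *)

Lemma nonincreasing_upto (R : realType) (z : nat -> R) n :
  (forall j, (j < n)%N -> z j.+1 <= z j) ->
  forall i k, (i <= k <= n)%N -> z k <= z i.
Proof.
move=> z_dec i k /andP[/subnK <-].
elim: (k - i)%N => [//|l IH] ln.
by apply: le_trans (IH (ltnW ln)); exact: z_dec.
Qed.

Section BangPropagation.
Variable R : realType.
Implicit Types (phi dphi H dH : R -> R).
Local Notation e := (expR 1 : R).

Lemma expR1_ge2 : 2 <= e.
Proof. by have := expR_ge1Dx (1 : R); lra. Qed.

Lemma ler_expRB1 (x : R) : x <= expR (x - 1).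
Proof. by have := expR_ge1Dx (x - 1); lra. Qed.

Lemma expRD1 (x : R) : e * expR x = expR (x + 1).
Proof. by rewrite -expRD addrC. Qed.

(** By concavity: r <= exp (r - 1) <= exp ((r - 1) w). *)
Lemma ler_scale_expR (r w : R) : 0 <= r <= 1 -> w <= 1 ->
  r * expR w <= expR (r * w).
Proof.
move=> /andP[r0 r1] w1.
have -> : r * w = (r - 1) * w + w by ring.
rewrite expRD ler_wpM2r ?expR_ge0// (le_trans (ler_expRB1 r))// ler_expR.
have : 0 <= (1 - r) * (1 - w) by apply: mulr_ge0; lra.
lra.
Qed.

(** An exponential of rate e b' that becomes a line of slope b when it reaches
    the value b / b' e^-1 stays below the exponential of the smaller rate e b
    which is tangent to the line: the line is bounded by x <= exp (x - 1), the
    early part by [ler_scale_expR]. *)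
Lemma bang_envelope (b b' s x v : R) : 0 < b -> b <= b' ->
  (x <= s + (e * b')^-1 -> v <= b / b' * expR (e * b' * (x - s) - 2)) ->
  (s + (e * b')^-1 <= x -> v <= b * (x - s)) ->
  v <= expR (e * b * (x - s) - 2).
Proof.
move=> b0 bb' early late.
have b'0 : 0 < b' by lra.
have e0 : 0 < e := expR_gt0 1.
have [xs|sx] := leP x (s + (e * b')^-1); last first.
  apply: (le_trans (late (ltW sx))).
  rewrite -(ler_pM2l e0) expRD1.
  have -> : e * b * (x - s) - 2 + 1 = e * b * (x - s) - 1 by lra.
  by rewrite mulrA; apply: ler_expRB1.
apply: (le_trans (early xs)).
have -> : e * b * (x - s) = b / b' * (e * b' * (x - s)) by field; lra.
rewrite !expRD mulrA ler_wpM2r ?expR_ge0// ler_scale_expR//.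
  by rewrite divr_ge0 ?(ltW b0, ltW b'0)//= ler_pdivrMr// mul1r.
rewrite -ler_pdivlMl ?mulr_gt0//; lra.
Qed.

(** By exp z >= 1 + z at z = (y - 1) / 2, the right-hand side is at least
    ((1 + y) / 2)^2 e^-2.  On [0, 2] this exceeds y^2 / 2 e^-2 by at least
    e^-2 / 4, which leaves room for the two initial errors. *)
Lemma quadratic_le_expR (y : R) : 0 <= y <= 2 ->
  expR (-5) + expR (-5) * (y / e) + (y / e) ^+ 2 / 2 <= expR (y - 3).
Proof.
move=> /andP[y0 y2].
have e2 := expR1_ge2.
have e0 : 0 < e := expR_gt0 1.
have -> : y - 3 = (y - 1) / 2 + (y - 1) / 2 - 2 by lra.
rewrite !expRD.
have sq : ((1 + y) / 2) ^+ 2 <= expR ((y - 1) / 2) * expR ((y - 1) / 2).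
  rewrite expr2 ler_pM//; try lra.
    by have := expR_ge1Dx ((y - 1) / 2); lra.
  by have := expR_ge1Dx ((y - 1) / 2); lra.
have em k : expR (- k%:R) = e^-1 ^+ k.
  by rewrite expRN -[k%:R]mulr1 expRM_natl exprVn.
rewrite !em.
set u := e^-1.
have u0 : 0 < u by rewrite invr_gt0.
have u2 : u <= 1 / 2 by rewrite mul1r lef_pV2 ?posrE.
apply: (@le_trans _ _ (((1 + y) / 2) ^+ 2 * u ^+ 2)); last first.
  by rewrite ler_wpM2r ?exprn_ge0// ltW.
have u3 : u ^+ 3 <= 1/8.
  have -> : (1/8 : R) = (1/2) ^+ 3 by lra.
  by rewrite lerXn2r ?nnegrE; lra.
have u4 : u ^+ 4 <= 1/16.
  have -> : (1/16 : R) = (1/2) ^+ 4 by lra.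
  by rewrite lerXn2r ?nnegrE; lra.
have -> : u ^+ 5 + u ^+ 5 * (y * u) + (y * u) ^+ 2 / 2 =
  (u ^+ 3 + u ^+ 4 * y + y ^+ 2 / 2) * u ^+ 2 by ring.
rewrite ler_wpM2r ?exprn_ge0 ?(ltW u0)//.
have : u ^+ 4 * y <= 1 / 16 * 2 by apply: ler_pM => //;
  rewrite exprn_ge0// ltW.
have : 0 <= y * (2 - y) by apply: mulr_ge0; lra.
rewrite !expr2; lra.
Qed.

(** G j stands for a normalised j-th derivative, and b for the weight A.  The
    motion goes from xi n to X, and meets the point xi j where G j is known to
    be small.  The smallness required there is a lower bound for the early
    envelope of [bang_envelope] at the starting point xi n. *)
Section Propagation.
Variables (n : nat) (b xi : nat -> R) (G dG : nat -> R -> R) (X : R).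
Hypothesis n_gt0 : (0 < n)%N.
Hypothesis b_gt0 : forall i, 0 < b i.
Hypothesis b_nd : forall i, b i <= b i.+1.
Hypothesis xi_dec : forall j, (j < n)%N -> xi j.+1 <= xi j.
Hypothesis GP : forall j (x : R), (j <= n)%N -> xi n < x < X ->
  is_derive x 1 (G j) (dG j x).
Hypothesis cG : forall j, (j <= n)%N -> {within `[xi n, X], continuous (G j)}.
Hypothesis dG_le : forall j x, (j <= n)%N -> xi n < x < X ->
  `|dG j x| <= b j.+1 * `|G j.+1 x|.
Hypothesis G_le1 : forall j x, (j <= n.+1)%N -> xi n <= x <= X ->
  `|G j x| <= 1.
Hypothesis G_xi : forall j, (j <= n)%N ->
  `|G j (xi j)| <= expR (- (n + 4)%:R) * (b j.+1 / b j.+2).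

(** The position at which the envelope of G j.-1 reaches the level 1/e. *)
Definition bang_time j := xi n + \sum_(j <= i < n.+2) (e * b i)^-1.

Let b_le i j : (i <= j)%N -> b i <= b j.
Proof. by move=> ij; apply: (homo_leq (@lexx _ R) (@le_trans _ R)). Qed.

Let xi_le j : (j <= n)%N -> xi n <= xi j.
Proof. by move=> jn; apply: (nonincreasing_upto xi_dec); rewrite jn leqnn. Qed.

Lemma bang_timeE j : (j <= n.+1)%N ->
  bang_time j = bang_time j.+1 + (e * b j)^-1.
Proof. by move=> jn; rewrite /bang_time big_ltn//; ring. Qed.

Lemma bang_time_ge j : xi n <= bang_time j.
Proof.
rewrite lerDl sumr_ge0// => i _; rewrite invr_ge0 mulr_ge0 ?expR_ge0//.
exact: ltW.
Qed.

Lemma bang_time_le j : (j <= n.+1)%N ->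
  e * b j * (bang_time j - xi n) <= (n.+2 - j)%:R.
Proof.
move=> jn; rewrite /bang_time [_ - xi n]addrAC subrr add0r big_distrr/=.
have -> : (n.+2 - j)%:R = \sum_(j <= i < n.+2) (1 : R)
  by rewrite sumr_const_nat.
apply: ler_sum_nat => i /andP[ji _].
have e0 : 0 < e := expR_gt0 1.
rewrite ler_pdivrMr ?mulr_gt0// mul1r ler_pM2l//; exact: b_le.
Qed.

(** H integrates a bound on b j.+1 * G j.+1.  It is used until the position
    s + 1 / (e b j.+2), from where on only |G j.+1| <= 1 is used. *)
Lemma bang_step j H dH : (j < n)%N ->
  let s := bang_time j.+2 in
  (forall x : R, is_derive x 1 H (dH x)) ->
  (forall x, xi n <= x -> H (xi n) <= H x) ->
  `|G j (xi j)| <= H (xi n) ->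
  (forall x, xi j < x < X -> b j.+1 * `|G j.+1 x| <= dH x) ->
  (forall x, xi n <= x <= s + (e * b j.+2)^-1 ->
    H x <= b j.+1 / b j.+2 * expR (e * b j.+2 * (x - s) - 2)) ->
  forall x, xi j <= x <= X ->
  `|G j x| <= expR (e * b j.+1 * (x - s) - 2).
Proof.
move=> jn s dHP H_ge Hxi G_dH H_le x xX.
have e0 : 0 < e := expR_gt0 1.
have xij : xi n <= xi j := xi_le (ltnW jn).
set s1 := s + (e * b j.+2)^-1.
have eb0 : 0 < (e * b j.+2)^-1 by rewrite invr_gt0 mulr_gt0.
have cs1 : xi n <= s1 by have := bang_time_ge j.+2; rewrite /s1 -/s; lra.
have [early late] : (x <= s1 -> `|G j x| <= H x) /\
    (s1 <= x -> `|G j x| <= H s1 + b j.+1 * (x - s1)).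
  apply: (@capped_growth R (G j) (dG j) H dH (b j.+1) (xi n) (xi j) X s1 x)
    => //.
  - exact: ltW.
  - by move=> y yX; apply: GP; [exact: ltnW|lra].
  - apply: continuous_subspaceW (cG (ltnW jn)) => y/=; rewrite !in_itv/=; lra.
  - by move=> y yX; apply: le_trans (G_dH _ yX); apply: dG_le;
    [exact: ltnW|lra].
  - move=> y yX; apply: le_trans (dG_le _ _) _; [exact: ltnW|lra|].
    by rewrite ler_piMr ?(ltW (b_gt0 _))// G_le1 ?ltnS ?(ltnW jn)//; lra.
apply: (bang_envelope (b_gt0 _) (b_nd _)) => [xs|sx].
  apply: le_trans (early xs) _; apply: H_le; rewrite xs andbT; lra.
apply: le_trans (late sx) _.
have := H_le s1; rewrite cs1 lexx => /(_ isT).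
have -> : e * b j.+2 * (s1 - s) - 2 = -1.
  rewrite /s1; have := b_gt0 j.+2; move: e0 => /[swap] ? ?; field; lra.
rewrite expRN => Hs1.
have : b j.+1 * (s1 - s) = b j.+1 / b j.+2 * e^-1.
  by rewrite /s1; have := b_gt0 j.+2; move: e0 => /[swap] ? ?; field; lra.
lra.
Qed.

(** Since G n.+1 is only bounded by 1, G n may start growing at once. *)
Lemma bang_base x : xi n <= x <= X ->
  `|G n x| <= expR (- (n + 4)%:R) + b n.+1 * (x - xi n).
Proof.
move=> /andP[cx xX].
have dB (y : R) : is_derive y 1 (fun z : R => b n.+1 * z) (b n.+1).
  by apply: is_derive_eq; rewrite /GRing.scale/=; ring.
have : `|G n x - G n (xi n)| <= b n.+1 * x - b n.+1 * xi n.
  apply: (ler_dist_dominated (dphi := dG n) cx _ _ dB) => [y yx||y yx].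
  - by apply: GP => //; lra.
  - apply: continuous_subspaceW (cG (leqnn n)) => y/=; rewrite !in_itv/=; lra.
  - apply: le_trans (dG_le _ _) _ => //; first lra.
    by rewrite ler_piMr ?(ltW (b_gt0 _))// G_le1//; lra.
have : `|G n (xi n)| <= expR (- (n + 4)%:R).
  apply: le_trans (G_xi _) _ => //.
  by rewrite ler_piMr ?expR_ge0// ler_pdivrMr// mul1r.
have := ler_normD (G n x - G n (xi n)) (G n (xi n)); rewrite subrK; lra.
Qed.

(** As bang_time j.+1 = bang_time j.+2 + 1 / (e b j.+1), the bound equals
    exp (e b_(j+1) (x - bang_time j.+1) - 1).  The induction starts at
    j = n - 1, because the linear bound on G n does not lie below the
    exponential one once an initial error is allowed: they are tangent. *)
Lemma bang_propagation j : (j < n)%N -> forall x, xi j <= x <= X ->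
  `|G j x| <= expR (e * b j.+1 * (x - bang_time j.+2) - 2).
Proof.
have e0 : 0 < e := expR_gt0 1.
move=> jn; have [m jm] : exists m, (j + m).+1 = n.
  by exists (n - j.+1)%N; rewrite -addSn subnKC.
elim: m j jn jm => [|m IH] j jn jm.
  (* for j = n - 1, integrate the linear bound on G n *)
  have jnE : j.+1 = n by rewrite -jm addn0.
  have b'0 := b_gt0 j.+2; have b0 := b_gt0 j.+1.
  have eb0 : 0 < e * b j.+2 by rewrite mulr_gt0.
  have sE : bang_time j.+2 = xi n + (e * b j.+2)^-1.
    by rewrite /bang_time jnE big_nat1.
  pose u : R := expR (- (n + 4)%:R).
  have u5 : u <= expR (- 5).
    by rewrite ler_expR lerN2 ler_nat (@leq_add 1 4 n 4).
  have u0 : 0 < u := expR_gt0 _.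
  pose H x := u * (b j.+1 / b j.+2)
    + b j.+1 * (u * (x - xi n) + b j.+2 * (x - xi n) ^+ 2 / 2).
  have Hc : H (xi n) = u * (b j.+1 / b j.+2) by rewrite /H; field; lra.
  apply: (@bang_step j H (fun x => b j.+1 * (u + b j.+2 * (x - xi n)))) => //.
  - by move=> x; apply: is_derive_eq; rewrite /GRing.scale/=; field.
  - move=> x cx; rewrite Hc /H lerDl.
    rewrite mulr_ge0 ?(ltW b0)// addr_ge0// ?mulr_ge0 ?exprn_ge0 ?invr_ge0//;
      lra.
  - by rewrite Hc; apply: G_xi; exact: ltnW.
  - move=> x xX; rewrite ler_pM2l// jnE; apply: bang_base.
    by have := xi_le (ltnW jn); lra.
  - move=> x; rewrite sE => /andP[cx xs].
    pose y := e * b j.+2 * (x - xi n).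
    have -> : e * b j.+2 * (x - (xi n + (e * b j.+2)^-1)) - 2 = y - 3.
      by rewrite /y; field; lra.
    have -> : H x = b j.+1 / b j.+2 * (u + u * (y / e) + (y / e) ^+ 2 / 2).
      by rewrite /H /y; field; lra.
    rewrite ler_pM2l ?divr_gt0//.
    have y02 : 0 <= y <= 2.
      rewrite /y mulr_ge0 ?(ltW eb0)//=; last lra.
      rewrite -ler_pdivlMl//; lra.
    apply: le_trans (quadratic_le_expR y02); rewrite lerD2r lerD//.
    by rewrite ler_wpM2r// divr_ge0 ?(ltW e0)//; case/andP: y02.
(* for smaller j, integrate the exponential envelope of G j.+1 *)
have jn1 : (j.+1 < n)%N by rewrite -jm addnS ltnS leq_addr.
have b'0 := b_gt0 j.+2; have b0 := b_gt0 j.+1.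
have eb0 : 0 < e * b j.+2 by rewrite mulr_gt0.
set s := bang_time j.+2.
pose H x := b j.+1 / b j.+2 * expR (e * b j.+2 * (x - s) - 2).
apply: (@bang_step j H (fun x =>
  b j.+1 * expR (e * b j.+2 * (x - s) - 1))) => //.
- move=> x; apply: is_derive_eq; rewrite /GRing.scale/=.
  have -> : e * b j.+2 * (x - s) - 1 = (e * b j.+2 * (x - s) - 2) + 1 by ring.
  by rewrite -expRD1; field; lra.
- move=> x cx; rewrite /H ler_pM2l ?divr_gt0// ler_expR lerD2r ler_pM2l//; lra.
- apply: (le_trans (G_xi (ltnW jn))); rewrite /H mulrC ler_pM2l ?divr_gt0//.
  rewrite ler_expR.
  have : e * b j.+2 * (s - xi n) <= (n.+2 - j.+2)%:R by apply: bang_time_le.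
  have : (n.+2 - j.+2)%:R <= n%:R :> R by rewrite ler_nat !subSS leq_subr.
  rewrite natrD; lra.
- move=> x xX; rewrite ler_pM2l//.
  apply: le_trans (IH j.+1 jn1 _ x _) _; first by rewrite -jm addnS addSn.
    by have := xi_dec jn; lra.
  rewrite ler_expR (_ : s = bang_time j.+3 + (e * b j.+2)^-1);
    last exact: bang_timeE.
  rewrite le_eqVlt; apply/orP; left; apply/eqP; field; lra.
Qed.

End Propagation.

End BangPropagation.

(** * Rolle chains and Lagrange interpolation *)

Section Interpolation.
Variable R : realType.
Implicit Types (F : nat -> R -> R) (p q : {poly R}).

Definition deriv_chain (a b : R) F := forall j,
  {within `[a, b], continuous (F j)} /\
  forall x, a < x < b -> is_derive x 1 (F j) (F j.+1 x).

Lemma deriv_chain_subpoly (a b : R) F p : deriv_chain a b F ->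
  deriv_chain a b (fun j x => F j x - p^`(j).[x]).
Proof.
move=> FP j; have [cF dF] := FP j; split=> [|x xab].
  move=> x; apply: continuousB; first exact: cF.
  apply: continuous_subspaceT => y; exact: continuous_horner.
have ? := dF x xab; have ? := is_derive_poly p^`(j) x.
by rewrite derivnS; apply: is_deriveB.
Qed.

(** Between consecutive zeros of F 0 there is a zero of F 1, and so on.  Taking
    the last zero at each level makes the sequence xi nonincreasing. *)
Lemma rolle_chain (a b : R) m F (z : nat -> R) : deriv_chain a b F ->
  (forall i, (i < m)%N -> z i < z i.+1) -> a <= z 0%N -> z m <= b ->
  (forall i, (i <= m)%N -> F 0%N (z i) = 0) ->
  exists xi : nat -> R, [/\ forall j, (j < m)%N -> xi j.+1 <= xi j,
    xi 0%N <= z m, z 0%N <= xi m & forall j, (j <= m)%N -> F j (xi j) = 0].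
Proof.
elim: m F z => [|m IH] F z FP z_inc az zb Fz.
  by exists (fun=> z 0%N); split=> // j; rewrite leqn0 => /eqP ->; exact: Fz.
have z_le i k : (i <= k <= m.+1)%N -> z i <= z k.
  move=> /andP[/subnK <-]; elim: (k - i)%N => [//|l IHl] lm.
  by apply: le_trans (IHl (ltnW lm)) _; exact/ltW/z_inc.
have /choice[w wP] i : exists y, (i <= m)%N -> z i < y < z i.+1 /\ F 1%N y = 0.
  have [im|//] := boolP (i <= m)%N; last by exists 0.
  have zi : z i < z i.+1 by apply: z_inc.
  have ai : a <= z i by apply: le_trans az _; apply: z_le; rewrite leqW.
  have ib : z i.+1 <= b by apply: le_trans zb; apply: z_le;
    rewrite ltnS im leqnn.
  have [] := @Rolle R (F 0%N) (z i) (z i.+1) zi.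
  - move=> x; rewrite in_itv/= => xi; have [_ dF] := FP 0%N.
    by case: (dF x) => //; lra.
  - have [cF _] := FP 0%N; apply: continuous_subspaceW cF => x/=.
    by rewrite !in_itv/=; lra.
  - by rewrite !Fz// ltnW.
  move=> c; rewrite in_itv/= => ci [_ c0]; exists c => _; split=> //.
  have [_ dF] := FP 0%N; case: (dF c); first lra.
  by move=> _ <-.
have FP' : deriv_chain a b (fun j => F j.+1) by move=> j; exact: FP.
have [||||xi [xi_dec xi0 xim Fxi]] := IH (fun j => F j.+1) w FP'.
- move=> i im; have [wi _] := wP i (ltnW im); have [wi1 _] := wP i.+1 im; lra.
- by have [w0 _] := wP 0%N isT; lra.
- by have [w0 _] := wP m (leqnn m); lra.
- by move=> i im; have [] := wP i im.
have [w0 _] := wP 0%N isT; have [wm _] := wP m (leqnn m).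
exists (fun j => if j is k.+1 then xi k else z m.+1); split=> //.
- by case=> [|j] jm /=; [lra|exact: xi_dec].
- by lra.
- by case=> [|j] jm /=; [exact: Fz|exact: Fxi].
Qed.

Lemma derivn_mul_XsubC q (c : R) j :
  (q * ('X - c%:P))^`(j) = q^`(j) * ('X - c%:P) + q^`(j.-1) *+ j.
Proof.
elim: j => [|j IH]; first by rewrite mulr0n addr0.
rewrite derivnS IH derivD derivM derivMn -derivnS derivXsubC mulr1 /= -addrA.
congr (_ + _); case: j {IH} => [|j /=]; first by rewrite addr0.
by rewrite -derivnS -mulrS.
Qed.

(** The j-th derivative of a product of m linear factors is a sum of
    m (m - 1) .. (m - j + 1) products of m - j factors. *)
Lemma derivn_prod_XsubC_le (zs : seq R) (s xi : R) j :
  (forall z, z \in zs -> `|xi - z| <= s) ->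
  `|(\prod_(z <- zs) ('X - z%:P))^`(j).[xi]|
    <= (size zs ^_ j)%:R * s ^+ (size zs - j).
Proof.
elim: zs j => [|z zs IH] j zsP.
  rewrite big_nil; case: j => [|j];
    first by rewrite hornerE normr1 ffactn0 expr0 mulr1.
  by rewrite derivnC hornerE normr0 mulr_ge0// exprn_ge0.
have s0 : 0 <= s by apply: le_trans (zsP z (mem_head _ _)).
have zsP' y : y \in zs -> `|xi - y| <= s by move=> yz; apply: zsP;
  rewrite inE yz orbT.
rewrite big_cons mulrC derivn_mul_XsubC !hornerE hornerMn /=.
apply: le_trans (ler_normD _ _) _.
have step1 : `|(\prod_(z <- zs) ('X - z%:P))^`(j).[xi] * (xi - z)|
    <= (size zs ^_ j)%:R * s ^+ ((size zs).+1 - j).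
  rewrite normrM.
  have [jz|zj] := leqP j (size zs); last first.
    apply: le_trans (_ : 0 * s <= _); last by rewrite ffact_small// !mul0r.
    apply: ler_pM => //; last exact/zsP/mem_head.
    by apply: le_trans (IH j zsP') _; rewrite ffact_small// mul0r.
  rewrite subSn// exprSr mulrA.
  by apply: ler_pM => //; [exact: IH|exact/zsP/mem_head].
apply: le_trans (lerD step1 (lexx _)) _.
case: j {step1} => [|j]; first by rewrite mulr0n normr0 addr0 !ffactn0.
rewrite /= normrMn subSS.
have IHj := IH j zsP'.
apply: (@le_trans _ _ ((size zs ^_ j.+1)%:R * s ^+ (size zs - j)
    + ((size zs ^_ j)%:R * s ^+ (size zs - j)) *+ j.+1)).
  by rewrite lerD2l lerMn2r IHj orbT.
rewrite -mulrnAl -mulrDl -mulrnA -natrD ler_wpM2r ?exprn_ge0// ler_nat.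
rewrite ffactnSr ffactnS /= -mulnDr.
have [jz|zj] := leqP j (size zs); last by rewrite ffact_small// !muln0.
by rewrite addnS subnK// mulnC.
Qed.

Section Nodes.
Variables (n : nat) (x y : nat -> R).

Definition basis_poly (i : 'I_n.+1) : {poly R} :=
  \prod_(k < n.+1 | k != i) ('X - (x k)%:P).

Definition basis_den (i : 'I_n.+1) : R :=
  \prod_(k < n.+1 | k != i) (x i - x k).

Definition interp : {poly R} :=
  \sum_(i < n.+1) (y i / basis_den i) *: basis_poly i.

Let seq_nodes i := [seq x k | k : 'I_n.+1 <- enum 'I_n.+1 & k != i].

Let basis_polyE i : basis_poly i = \prod_(z <- seq_nodes i) ('X - z%:P).
Proof. by rewrite big_map big_filter big_enum_cond. Qed.

Let size_seq_nodes i : size (seq_nodes i) = n.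
Proof.
rewrite size_map size_filter.
have -> : count (fun k => k != i) (enum 'I_n.+1) = #|predC1 i|.
  by rewrite cardE enumT /enum_mem -enumT size_filter; apply: eq_count.
by rewrite cardC1 card_ord.
Qed.

Lemma size_interp : (size interp <= n.+1)%N.
Proof.
apply: (leq_trans (size_sum _ _ _)); apply/bigmax_leqP => i _.
apply: (leq_trans (size_scale_leq _ _)).
by rewrite basis_polyE size_prod_XsubC size_seq_nodes.
Qed.

Section Gaps.
Variable (delta : R).
Hypothesis delta_gt0 : 0 < delta.
Hypothesis gap : forall i, (i < n)%N -> x i + delta <= x i.+1.

Lemma node_gap i k : (i <= k <= n)%N -> (k - i)%:R * delta <= x k - x i.
Proof.
move=> /andP[/subnK <-]; rewrite addnK.
elim: (k - i)%N => [|l IHl] lm; first by rewrite mul0r subrr.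
have := IHl (ltnW lm); have := gap lm;
  rewrite addSn -[l.+1]addn1 natrD mulrDl mul1r; lra.
Qed.

Lemma node_inj (i k : 'I_n.+1) : k != i -> x i - x k != 0.
Proof.
move=> ki; rewrite subr_eq0.
have [ik|ik|/val_inj ik] := ltngtP i k; last by rewrite ik eqxx in ki.
  have := @node_gap i k; rewrite (ltnW ik) -ltnS ltn_ord => /(_ isT).
  rewrite lt_eqF// -subr_gt0; apply: lt_le_trans (node_gap _).
    by rewrite mulr_gt0// ltr0n subn_gt0.
  by rewrite (ltnW ik) -ltnS ltn_ord.
rewrite gt_eqF// -subr_gt0; apply: lt_le_trans (node_gap _).
  by rewrite mulr_gt0// ltr0n subn_gt0.
by rewrite (ltnW ik) -ltnS ltn_ord.
Qed.

Lemma basis_den_neq0 i : basis_den i != 0.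
Proof. by apply/prodf_neq0 => k /node_inj. Qed.

Lemma interpE (k : 'I_n.+1) : interp.[x k] = y k.
Proof.
rewrite /interp horner_sum (bigD1 k)//= big1 ?addr0 => [|i ik].
  rewrite hornerZ /basis_poly horner_prod.
  under eq_bigr do rewrite hornerXsubC.
  by rewrite divfK// basis_den_neq0.
rewrite hornerZ /basis_poly horner_prod (bigD1 k)/=; last by rewrite eq_sym.
by rewrite hornerXsubC subrr mul0r mulr0.
Qed.

Lemma prod_nat_ge (f : nat -> R) m :
  (forall k, (k < m)%N -> k.+1%:R * delta <= f k) ->
  m`!%:R * delta ^+ m <= \prod_(0 <= k < m) f k.
Proof.
elim: m => [|m IH] fP; first by rewrite big_geq// fact0 mulr1.
rewrite big_nat_recr//= factS natrM exprSr.
have -> : m.+1%:R * m`!%:R * (delta ^+ m * delta) =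
   (m`!%:R * delta ^+ m) * (m.+1%:R * delta) by ring.
apply: ler_pM.
- by rewrite mulr_ge0// exprn_ge0// ltW.
- by rewrite mulr_ge0// ltW.
- by apply: IH => k km; apply: fP; exact: ltnW.
- exact: fP.
Qed.

(** The distances from the i-th node to the nodes on its left are at least
    delta, 2 delta, .., i delta, and similarly on its right. *)
Lemma basis_den_ge (i : 'I_n.+1) :
  delta ^+ n * (i`! * (n - i)`!)%:R <= `|basis_den i|.
Proof.
rewrite /basis_den normr_prod.
rewrite -(big_mkord (fun k => k != i) (fun k => `|x i - x k|)).
have ile : (i <= n)%N by rewrite -ltnS.
rewrite (@big_cat_nat _ _ _ i)//=; last by rewrite leqW.
rewrite (@big_ltn_cond _ _ _ i)//= eqxx /=.
have -> : \prod_(0 <= k < i | k != i) `|x i - x k| =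
    \prod_(0 <= k < i) `|x i - x k|.
  rewrite big_nat_cond [RHS]big_nat_cond; apply: eq_bigl => k.
  by case: (ltnP k i) => ki; rewrite ?andbF//= ?andbT ltn_eqF.
have -> : \prod_(i.+1 <= k < n.+1 | k != i) `|x i - x k| =
    \prod_(0 <= k < n - i) `|x i - x (k + i.+1)%N|.
  rewrite -(add0n i.+1) big_addn subSS big_nat_cond [RHS]big_nat_cond.
  apply: eq_bigl => k; case: ltnP => //= _.
  by rewrite gtn_eqF// addnS ltnS leq_addl.
rewrite big_nat_rev/= natrM.
have -> : delta ^+ n * (i`!%:R * (n - i)`!%:R) =
  (i`!%:R * delta ^+ i) * ((n - i)`!%:R * delta ^+ (n - i)).
  by rewrite -{1}(subnKC ile) exprD; ring.
apply: ler_pM; try by rewrite mulr_ge0// exprn_ge0// ltW.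
  apply: prod_nat_ge => k ki; rewrite add0n.
  have := @node_gap (i - k.+1) i; rewrite leq_subr ile subKn// => /(_ isT).
  by move/le_trans; apply; exact: ler_norm.
apply: prod_nat_ge => k ki; rewrite distrC.
have := @node_gap i (k + i.+1); rewrite addnS -addSn leq_addl addnK /=.
rewrite -(leq_add2r i) subnK// in ki.
by move=> /(_ ki) /le_trans; apply; exact: ler_norm.
Qed.

(** The factor 2^n is the sum of the binomial coefficients n! / (i! (n-i)!)
    produced by [basis_den_ge]. *)
Lemma interp_deriv_le (eta s xi : R) j :
  (forall i, (i <= n)%N -> `|y i| <= eta) ->
  (forall i, (i <= n)%N -> `|xi - x i| <= s) ->
  `|interp^`(j).[xi]| <=
    eta * (n ^_ j)%:R * s ^+ (n - j) * (2 ^+ n / (n`!%:R * delta ^+ n)).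
Proof.
move=> y_le xi_le.
have eta0 : 0 <= eta by apply: le_trans (y_le 0%N isT).
have s0 : 0 <= s by apply: le_trans (xi_le 0%N isT).
have -> : interp^`(j).[xi] =
    \sum_(i < n.+1) (y i / basis_den i) * (basis_poly i)^`(j).[xi].
  rewrite /interp linear_sum horner_sum; apply: eq_bigr => i _.
  by rewrite /= derivnZ hornerZ.
apply: le_trans (ler_norm_sum _ _ _) _.
have -> : 2 ^+ n / (n`!%:R * delta ^+ n) =
    \sum_(i < n.+1) (delta ^+ n * (i`! * (n - i)`!)%:R)^-1 :> R.
  have -> : (2 : R) = 1 + 1 by ring.
  rewrite exprDn mulr_suml; apply: eq_bigr => i _.
  have <- : 'C(n, i)%:R * (i`! * (n - i)`!)%:R = n`!%:R :> R.
    by rewrite -natrM bin_fact// -ltnS.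
  have f0 : (i`! * (n - i)`!)%:R != 0 :> R.
    by rewrite pnatr_eq0 muln_eq0 negb_or -!lt0n !fact_gt0.
  have b0 : 'C(n, i)%:R != 0 :> R by rewrite pnatr_eq0 -lt0n bin_gt0 -ltnS.
  have d0 : delta ^+ n != 0 by rewrite expf_neq0// gt_eqF.
  rewrite !expr1n mulr1 -[1 *+ _]/('C(n, i)%:R).
  move: (_`! * _)%:R ('C(n, i)%:R) (delta ^+ n) f0 b0 d0 => u v w u0 v0 w0.
  by field; rewrite u0 v0 w0.
rewrite mulr_sumr; apply: ler_sum => i _.
have ile : (i <= n)%N by rewrite -ltnS.
rewrite normrM normrM normfV -!mulrA.
apply: ler_pM.
- exact: normr_ge0.
- by rewrite mulr_ge0 ?invr_ge0 ?normr_ge0.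
- exact: y_le.
rewrite mulrC mulrA; apply: ler_pM => //.
  rewrite basis_polyE.
  have := @derivn_prod_XsubC_le (seq_nodes i) s xi j; rewrite size_seq_nodes;
    apply.
  by move=> z /mapP[k _ ->]; apply: xi_le; rewrite -ltnS.
have ? := basis_den_ge i.
rewrite lef_pV2// posrE ?normr_gt0 ?basis_den_neq0//.
by rewrite mulr_gt0 ?exprn_gt0// ltr0n muln_gt0 !fact_gt0.
Qed.

End Gaps.
End Nodes.

Lemma derivn_size_monic p m : p \is monic -> size p = m.+1 ->
  p^`(m) = (m`!%:R)%:P.
Proof.
move=> /monicP lp sp; apply/polyP => i; rewrite coef_derivn coefC.
case: i => [|i] /=.
  by rewrite addn0 ffactnn; move: lp; rewrite lead_coefE sp /= => ->.
by rewrite nth_default ?mul0rn// sp addnS ltnS leq_addr.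
Qed.

(** Add to the interpolant the multiple of the nodal polynomial that makes it
    agree with F 0 at y as well, and apply [rolle_chain] to the n + 2 zeros of
    the difference. *)
Lemma interp_remainder (a b : R) F n (x : nat -> R) (delta y K s : R) :
  deriv_chain a b F -> 0 < delta ->
  (forall i, (i < n)%N -> x i + delta <= x i.+1) ->
  (forall i, (i <= n)%N -> a <= x i <= b) -> a <= y <= b ->
  (forall t, a <= t <= b -> `|F n.+1 t| <= K) ->
  (forall i, (i <= n)%N -> `|y - x i| <= s) ->
  `|F 0%N y - (interp n x (fun i => F 0%N (x i))).[y]|
    <= K * (s ^+ n.+1 / (n.+1)`!%:R).
Proof.
move=> FP d0 gap xab yab FK ys.
have f0 : 0 < (n.+1)`!%:R :> R by rewrite ltr0n fact_gt0.
set P := interp _ _ _; pose zs := mkseq x n.+1.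
have zsP z : z \in zs -> exists2 k : 'I_n.+1, z = x k & true.
  by move=> /mapP[k]; rewrite mem_iota /= => kn ->; exists (Ordinal kn).
have szs : size zs = n.+1 by rewrite size_mkseq.
have Fx k : (k <= n)%N -> F 0%N (x k) = P.[x k].
  rewrite -ltnS => kn.
  by have := interpE (fun i => F 0%N (x i)) d0 gap (Ordinal kn) => /= ->.
have s0 : 0 <= s by apply: le_trans (ys 0%N isT).
have K0 : 0 <= K by apply: le_trans (FK y yab).
have [|ynz] := boolP (y \in zs).
  move=> /zsP[k -> _]; rewrite (Fx _ (ltn_ord k)) subrr normr0.
  by rewrite mulr_ge0 ?divr_ge0 ?exprn_ge0 ?(ltW f0).
pose W := \prod_(z <- zs) ('X - z%:P).
have Wy0 : W.[y] != 0.
  by have := root_prod_XsubC zs y; rewrite /root -/W => ->.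
pose c := (F 0%N y - P.[y]) / W.[y].
pose Q := P + c *: W.
have QF : F 0%N y - Q.[y] = 0.
  by rewrite /Q hornerD hornerZ /c divfK//; ring.
have Qz z : z \in zs -> F 0%N z - Q.[z] = 0.
  move=> zz; have := root_prod_XsubC zs z; rewrite zz -/W /root => /eqP Wz.
  move: zz => /zsP[k -> _] in Wz *.
  by rewrite /Q hornerD hornerZ Wz mulr0 addr0 (Fx _ (ltn_ord k)) subrr.
pose ws := sort <=%R (y :: zs).
have sizews : size ws = n.+2 by rewrite size_sort -szs.
have uz : uniq zs.
  apply/mkseq_uniqP => i k; rewrite !inE => ik kk.
  apply: contra_eq => nik.
  have := @node_inj n x delta d0 gap (Ordinal ik) (Ordinal kk);
    rewrite subr_eq0 /=.
  by apply; rewrite -val_eqE eq_sym.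
have ws_sorted : sorted <%R ws by rewrite sort_lt_sorted cons_uniq ynz uz.
have mem_ws z : z \in ws -> a <= z <= b /\ F 0%N z - Q.[z] = 0.
  rewrite mem_sort inE => /predU1P[->//|zz]; split; last exact: Qz.
  by move: zz => /zsP[k -> _]; apply: xab; exact: (ltn_ord k).
have wsn i : (i <= n.+1)%N -> nth 0 ws i \in ws.
  by move=> im; apply: mem_nth; rewrite sizews ltnS.
have [||||xi [xi_dec xi0 xin Fxi]] := rolle_chain (m := n.+1) (z := nth 0 ws)
    (deriv_chain_subpoly Q FP).
- by move=> i im; apply: sorted_ltn_nth => //; [exact: lt_trans|
    rewrite inE sizews ltnS ltnW|rewrite inE sizews].
- by have [/andP[]] := mem_ws _ (wsn 0%N isT).
- by have [/andP[]] := mem_ws _ (wsn n.+1 (leqnn _)).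
- by move=> i im; have [_] := mem_ws _ (wsn i im).
have xin_ab : a <= xi n.+1 <= b.
  have [/andP[h1 _] _] := mem_ws _ (wsn 0%N isT).
  have [/andP[_ h2] _] := mem_ws _ (wsn n.+1 (leqnn _)).
  have := nonincreasing_upto xi_dec (_ : 0 <= n.+1 <= n.+1)%N.
  by rewrite leqnn => /(_ isT); lra.
have := Fxi n.+1 (leqnn _).
rewrite /Q derivnD derivnZ (derivn_poly0 (size_interp _ _ _)) add0r.
set N := (n.+1)`!%:R in f0 *.
rewrite (@derivn_size_monic W n.+1) ?monic_prod_XsubC ?size_prod_XsubC ?szs//
  -/N.
rewrite hornerZ hornerC => /eqP; rewrite subr_eq0 => /eqP FE.
have cK : `|c| <= K / N.
  by rewrite ler_pdivlMr// -[X in _ * X]gtr0_norm// -normrM -FE; exact: FK.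
have -> : F 0%N y - P.[y] = c * W.[y] by rewrite /c divfK.
have -> : K * (s ^+ n.+1 / N) = K / N * s ^+ n.+1 by ring.
rewrite normrM; apply: ler_pM => //.
have := @derivn_prod_XsubC_le zs s y 0.
by rewrite derivn0 ffactn0 mul1r subn0 szs; apply => z /zsP[k -> _];
  apply: ys; exact: (ltn_ord k).
Qed.

(** Exchanges motions to the right and to the left. *)
Lemma deriv_chain_reflect (F : nat -> R -> R) : deriv_chain 0 1 F ->
  deriv_chain 0 1 (fun j t => (-1) ^+ j * F j (1 - t)).
Proof.
move=> FP j; have [/subspace_continuousP cF dF] := FP j; split.
  apply/subspace_continuousP => t; rewrite /= in_itv/= => t01.
  apply: cvgMl_tmp; apply/cvgrPdist_lt => eps eps0; rewrite near_withinE.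
  have t01' : (`[0, 1]%classic : set R) (1 - t) by rewrite /= in_itv/=; lra.
  have /cvgrPdist_lt/(_ eps eps0) := cF _ t01'; rewrite near_withinE => H.
  have r_cvg : 1 - y @[y --> t] --> 1 - t by apply: cvgB;
    [exact: cvg_cst|exact: cvg_id].
  have {}H : \forall y \near t, (`[0, 1]%classic : set R) (1 - y) ->
    `|F j (1 - t) - F j (1 - y)| < eps by exact: (r_cvg _ H).
  near=> y => /=; rewrite in_itv/= => y01.
  by apply: (near H y) => //; rewrite /= in_itv/=; lra.
move=> t t01.
have dt : is_derive (1 - t) 1 (F j) (F j.+1 (1 - t)) by apply: dF; lra.
have dr : is_derive t 1 (fun u : R => 1 - u) (-1).
  by apply: is_derive_eq; rewrite add0r mul1r.
have dc := is_derive1_comp (f := F j) (g := fun u : R => 1 - u) dt dr.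
have := @is_deriveZ R R R (F j \o (fun u : R => 1 - u)) ((-1) ^+ j) t 1 _ dc.
rewrite exprS /GRing.scale/=.
by have -> : (-1) ^+ j * (F j.+1 (1 - t) * -1) =
  -1 * (-1) ^+ j * F j.+1 (1 - t) by ring.
Unshelve. all: by end_near. Qed.

End Interpolation.

(** * Well-separated points in a set of positive length *)

Section Separation.
Variable R : realType.
Implicit Types (A B E : set R).

Lemma length_muE E : length E = fine ((@wlength R idfun)^*%mu E).
Proof. by []. Qed.

Lemma lebesgue_muE E : (lebesgue_measure (E : set (measurableTypeR R))) =
  (@wlength R idfun)^*%mu E.
Proof. by []. Qed.

Lemma mu_itv (a b : R) : a <= b ->
  (@wlength R idfun)^*%mu (`[a, b]) = (b - a)%:E.
Proof.
move=> ab; have := lebesgue_measure_itv `[a, b].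
rewrite lebesgue_muE => ->; rewrite /= lte_fin; case: ltP => [_|ba];
  first by [].
by congr (_%:E); lra.
Qed.

Lemma mu_fin E (a b : R) : E `<=` `[a, b] ->
  (@wlength R idfun)^*%mu E \is a fin_num.
Proof.
move=> Eab; have [ab|ba] := leP a b; last first.
  have -> : E = set0 by apply/seteqP; split=> // x /Eab /=; rewrite in_itv/=;
    lra.
  by rewrite outer_measure0.
rewrite ge0_fin_numE ?outer_measure_ge0//.
apply: (@le_lt_trans _ _ ((@wlength R idfun)^*%mu `[a, b])).
  exact: le_outer_measure.
by rewrite mu_itv// ltry.
Qed.

Lemma length0 : length (set0 : set R) = 0.
Proof. by rewrite length_muE outer_measure0. Qed.

Lemma length_itv (a b : R) : a <= b -> length `[a, b] = b - a.
Proof. by move=> ab; rewrite length_muE mu_itv. Qed.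

Lemma le_length A B (a b : R) : A `<=` B -> B `<=` `[a, b] ->
  length A <= length B.
Proof.
move=> AB Bab; rewrite !length_muE fine_le ?(mu_fin Bab)//.
  by apply: mu_fin; exact: subset_trans Bab.
exact: le_outer_measure.
Qed.

Lemma length_setU_le A B (a b : R) : A `|` B `<=` `[a, b] ->
  length (A `|` B) <= length A + length B.
Proof.
move=> ABab; rewrite !length_muE.
have fA := mu_fin (subset_trans (@subsetUl _ A B) ABab).
have fB := mu_fin (subset_trans (@subsetUr _ A B) ABab).
rewrite -fineD// fine_le ?(mu_fin ABab) ?fin_numD ?fA//.
exact: outer_measureU2.
Qed.

(** Greedy choice from the left: a point y of E within eta of inf E and the
    interval of length delta after it use up a length at most eta + delta. *)
Lemma separated_points m E (delta : R) : 0 <= delta -> E `<=` `[0, 1] ->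
  m%:R * delta < length E ->
  exists x : nat -> R, (forall i, (i <= m)%N -> E (x i)) /\
    (forall i, (i < m)%N -> x i + delta <= x i.+1).
Proof.
move=> d0; elim: m E => [|m IH] E E01 mE.
  have [E0|/set0P[x Ex]] := eqVneq E set0.
    by move: mE; rewrite E0 length0 mul0r ltxx.
  by exists (fun=> x); split.
have En0 : E !=set0.
  apply/set0P/eqP => E0; move: mE; rewrite E0 length0 => /lt_geF.
  by rewrite mulr_ge0.
have Einf : has_inf E.
  by split=> //; exists 0 => x /E01 /=; rewrite in_itv/= => /andP[].
pose eta := length E - m.+1%:R * delta.
have eta0 : 0 < eta by rewrite subr_gt0.
have [y Ey y_lt] := inf_adherent eta0 Einf.
have y_ge : inf E <= y by apply: ge_inf => //; case: Einf.
pose E1 := E `&` `]y + delta, +oo[.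
have E1E : E1 `<=` E by apply: subIsetl.
have E_sub : E `<=` `[inf E, y + delta] `|` E1.
  move=> x Ex /=; rewrite /E1/= !in_itv/= andbT.
  have : inf E <= x by apply: ge_inf => //; case: Einf.
  by move=> ->; case: leP; [left|right].
have i0 : 0 <= inf E.
  by apply: lb_le_inf => // x /E01 /=; rewrite in_itv/= => /andP[].
have U_sub : `[inf E, y + delta] `|` E1 `<=` `[0, 1 + delta].
  move=> x [|/E1E/E01] /=; rewrite !in_itv/=; last by lra.
  by have := E01 _ Ey; rewrite /= in_itv/=; lra.
have : length E <= (y + delta - inf E) + length E1.
  rewrite -length_itv; last lra.
  by apply: le_trans (le_length E_sub U_sub) (length_setU_le U_sub).
move=> lenE.
have [|x [Ex x_gap]] := IH E1 (subset_trans E1E E01).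
  by move: lenE; rewrite /eta -natr1 mulrDl mul1r in y_lt *; lra.
exists (fun i => if i is k.+1 then x k else y); split.
  by case=> [//|i] im; apply/E1E/Ex.
case=> [|i] im; last exact: x_gap.
by have [_] := Ex 0%N isT; rewrite /= in_itv/= andbT => /ltW.
Qed.

End Separation.

(** * From one-sided derivatives on an interval to ordinary ones *)

Section DerivativesOnSets.
Variable R : realType.
Implicit Types (f g : R -> R) (D : set R).

Lemma derive_on_cvg D f x : derivable_on D f -> D x ->
  (f y - f x) / (y - x) @[y --> within D x^'] --> derive_on D f x.
Proof. by move=> df Dx; exact: (df x Dx). Qed.

(** In the interior of D, the filter within D x^' is x^' itself. *)
Lemma is_derive_interior D f (x : R) : derivable_on D f -> D x -> nbhs x D ->
  is_derive x 1 f (derive_on D f x).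
Proof.
move=> df Dx nDx; have := derive_on_cvg df Dx; move: (derive_on D f x) => l fl.
have : h^-1 *: ((f \o shift x) (h *: 1) - f x) @[h --> 0^'] --> l.
  apply/cvgrPdist_lt => e e0.
  move/cvgrPdist_lt: fl => /(_ e e0).
  rewrite !near_withinE => H.
  have {nDx}H : \forall y \near x, y != x -> `|l - (f y - f x) / (y - x)| < e.
    by near=> y => yx; apply: (near H y) => //; near: y.
  rewrite (near_shift 0) in H.
  near=> h => h0.
  have H' : h + x != x -> `|l - (f (h + x) - f x) / (h + x - x)| < e.
    by rewrite -[X in h + X]subr0; apply: (near H h).
  rewrite addrK -subr_eq0 addrK in H'.
  rewrite /= [_ *: _]mulrC [h *: 1]mulr1.
  exact: H'.
move=> hl; apply: DeriveDef; first by apply/cvg_ex; exists l.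
exact: cvg_lim hl.
Unshelve. all: by end_near. Qed.

Lemma derivable_on_continuous D f : derivable_on D f ->
  {within D, continuous f}.
Proof.
move=> df; apply/subspace_continuousP => x Dx.
have := derive_on_cvg df Dx; move: (derive_on D f x) => l /cvgrPdist_lt.
move=> /(_ 1 ltr01); rewrite !near_withinE => H.
apply/cvgrPdist_lt => e e0; rewrite near_withinE.
have c0 : 0 < `|l| + 1 by rewrite ltr_wpDl.
near=> y => Dy.
have [->|yx] := eqVneq y x; first by rewrite subrr normr0.
have q1 : `|l - (f y - f x) / (y - x)| < 1 by apply: (near H y).
have xy : `|x - y| < e / (`|l| + 1).
  by near: y; apply: nbhsx_ballx; rewrite divr_gt0.
have yx0 : y - x != 0 by rewrite subr_eq0.
have -> : f x - f y = (f y - f x) / (y - x) * (x - y) by field.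
rewrite normrM.
have q2 : `|(f y - f x) / (y - x)| <= `|l| + 1.
  have := ler_normB l (l - (f y - f x) / (y - x)).
  by rewrite opprB addrC subrK; lra.
apply: (@le_lt_trans _ _ ((`|l| + 1) * `|x - y|)); first by rewrite ler_wpM2r.
by rewrite mulrC -ltr_pdivlMr.
Unshelve. all: by end_near. Qed.

Lemma within_continuous_bounded g (a b : R) : {within `[a, b], continuous g} ->
  exists K, forall x, a <= x <= b -> `|g x| <= K.
Proof.
move=> cg; have [ab|ba] := leP a b; last by exists 0 => x; lra.
have [|c _ cP] := @EVT_max R (fun x => `|g x|) a b ab.
  move=> x; apply: continuous_comp; first exact: cg.
  exact: norm_continuous.
by exists `|g c| => x xab; apply: cP; rewrite in_itv.
Qed.

Lemma smooth_on_chain f : smooth_on `[0, 1] f ->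
  deriv_chain 0 1 (fun j => deriven_on `[0, 1] j f).
Proof.
move=> fs j; split; first exact: derivable_on_continuous.
move=> x x01; apply: is_derive_interior; first exact: fs.
  by rewrite /= in_itv/=; lra.
apply: (@filterS _ _ _ `]0, 1[); first by move=> y /=; rewrite !in_itv/=; lra.
by apply: open_nbhs_nbhs; split=> //=; rewrite in_itv.
Qed.

Lemma ler_supnorm (K : set R) g (B x : R) : (forall y, K y -> `|g y| <= B) ->
  K x -> `|g x| <= supnorm K g.
Proof.
move=> gB Kx; apply: ub_le_sup; last by exists x.
by exists B => _ [y Ky <-]; exact: gB.
Qed.

End DerivativesOnSets.

(** * Numerical constants *)

Section Constants.
Variable R : realType.

Lemma expX_fact_le (x : R) m : 0 <= x -> x ^+ m / m`!%:R <= expR x.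
Proof.
move=> x0; case: m => [|m]; first by rewrite fact0 expr0 divr1 -expR0 ler_expR.
by apply: le_trans (expR_ge1Dxn m x0); rewrite lerDr.
Qed.

Lemma expnS_le_fact m : m.+1%:R ^+ m <= expR m.+1%:R * m`!%:R :> R.
Proof.
have f0 : 0 < (m.+1)`!%:R :> R by rewrite ltr0n fact_gt0.
have := @expX_fact_le m.+1%:R m.+1 (ler0n _ _).
rewrite ler_pdivrMr// factS natrM exprS mulrCA ler_pM2l//.
Qed.

(** With gaps delta = l / (2(n+1)) the bound of [interp_deriv_le] is at most
    eta (n/s)^j (4 s / l)^n (n+1)^n / n!, and (n+1)^n / n! <= e^(n+1). *)
Lemma interp_deriv_const_le (n j : nat) (eta s l W : R) :
  (0 < n)%N -> (j <= n)%N -> 0 <= eta -> 0 < l -> l <= s ->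
  eta * expR (2 * n + 5)%:R * (4 * s / l) ^+ n <= W * (s / n%:R) ^+ j ->
  eta * (n ^_ j)%:R * s ^+ (n - j) *
    (2 ^+ n / (n`!%:R * (l / (2 * n.+1%:R)) ^+ n)) <=
  expR (- (n + 4)%:R) * W.
Proof.
move=> n0 jn eta0 l0 ls H.
have s0 : 0 < s by lra.
have nR : 0 < n%:R :> R by rewrite ltr0n.
have f0 : 0 < n`!%:R :> R by rewrite ltr0n fact_gt0.
have sn0 : 0 < (s / n%:R) ^+ j by rewrite exprn_gt0// divr_gt0.
have ff : (n ^_ j)%:R <= n%:R ^+ j :> R.
  rewrite -natrX ler_nat; elim: j {jn H sn0} => [//|j IH].
  by rewrite ffactnSr expnSr leq_mul// leq_subr.
rewrite -(ler_pM2r sn0).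
apply: (@le_trans _ _ (eta * s ^+ n *
    (2 ^+ n / (n`!%:R * (l / (2 * n.+1%:R)) ^+ n)))).
  have c0 : 0 <= 2 ^+ n / (n`!%:R * (l / (2 * n.+1%:R)) ^+ n) :> R.
    by rewrite divr_ge0 ?exprn_ge0// mulr_ge0 ?(ltW f0)// exprn_ge0//
      divr_ge0 ?(ltW l0)// mulr_ge0.
  have -> : s ^+ n = s ^+ j * s ^+ (n - j) by rewrite -exprD subnKC.
  move: (2 ^+ n / _) c0 => C c0.
  have -> : eta * (n ^_ j)%:R * s ^+ (n - j) * C * (s / n%:R) ^+ j =
      eta * (s ^+ j * s ^+ (n - j)) * C * ((n ^_ j)%:R / n%:R ^+ j).
    by rewrite expr_div_n; ring.
  rewrite ler_piMr//; first by rewrite !mulr_ge0// exprn_ge0// ltW.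
  by rewrite ler_pdivrMr ?exprn_gt0// mul1r.
rewrite -[leRHS]mulrA; apply: le_trans (ler_wpM2l (expR_ge0 _) H).
have -> : expR (- (n + 4)%:R) * (eta * expR (2 * n + 5)%:R * (4 * s / l) ^+ n)
    = eta * (expR (n.+1)%:R * (4 * s / l) ^+ n).
  have -> : (2 * n + 5)%:R = (n + 4)%:R + n.+1%:R :> R.
    by rewrite -natrD; congr (_%:R); lia.
  rewrite expRD expRN; move: (expR_gt0 ((n + 4)%:R : R)).
  move: (expR (n + 4)%:R) ((4 * s / l) ^+ n) => u z u0; field; lra.
rewrite -mulrA ler_wpM2l//.
have -> : s ^+ n * (2 ^+ n / (n`!%:R * (l / (2 * n.+1%:R)) ^+ n)) =
   n.+1%:R ^+ n / n`!%:R * (4 * s / l) ^+ n.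
  have -> : 4 * s / l = s * 2 * (2 / l) by field; lra.
  have -> : l / (2 * n.+1%:R) = (2 / l)^-1 * n.+1%:R^-1.
    by move: (n.+1%:R : R) (ltr0Sn R n) => u u0; field; lra.
  have v0 : 0 < 2 / l by rewrite divr_gt0.
  move: (2 / l) (n.+1%:R : R) v0 (ltr0Sn R n) => v u v0 u0.
  rewrite !exprMn !exprVn.
  move: (u ^+ n) (v ^+ n) (exprn_gt0 n u0) (exprn_gt0 n v0) => a c a0 c0.
  by field; rewrite !gt_eqF.
rewrite ler_wpM2r ?exprn_ge0 ?divr_ge0 ?mulr_ge0 ?(ltW s0) ?(ltW l0)//.
by rewrite ler_pdivrMr// expnS_le_fact.
Qed.

(** With z = 4 s / l >= 4, one has 2 z^n <= z^(2n); the powers e^(8n) and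
    e^(2ng) come from e^(4+g). *)
Lemma Gamma_power_ge (n m : nat) (s l g eta : R) :
  (0 < n)%N -> (m <= 8 * n)%N -> 0 < l -> l <= s -> 0 <= g -> 0 <= eta ->
  2 * (expR (g * (2 * n)%:R) * (eta * expR m%:R * (4 * s / l) ^+ n)) <=
  (4 * expR (4 + g) * s / l) ^+ (2 * n) * eta.
Proof.
move=> n0 mn l0 ls g0 eta0.
have z4 : 4 <= 4 * s / l by rewrite ler_pdivlMr//; lra.
have -> : 4 * expR (4 + g) * s / l = expR (4 + g) * (4 * s / l) by ring.
move: (4 * s / l) z4 => z z4.
rewrite exprMn -expRM_natl.
have -> : (2 * n)%:R * (4 + g) = (8 * n)%:R + g * (2 * n)%:R.
  by rewrite mulrDr [g * _]mulrC; congr (_ + _); rewrite -natrM;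
    congr (_%:R); lia.
rewrite expRD mul2n -addnn exprD addnn -mul2n.
have zn : 2 <= z ^+ n.
  case: n n0 {mn} => [//|n] _; rewrite exprS -[2]mulr1; apply: ler_pM => //;
    first lra.
  by rewrite exprn_ege1//; lra.
have em : expR m%:R <= expR (8 * n)%:R :> R by rewrite ler_expR ler_nat.
have zz : 2 * z ^+ n <= z ^+ n * z ^+ n by rewrite ler_wpM2r//; lra.
have -> : 2 * (expR (g * (2 * n)%:R) * (eta * expR m%:R * z ^+ n)) =
    eta * expR (g * (2 * n)%:R) * (expR m%:R * (2 * z ^+ n)) by ring.
have -> : expR (8 * n)%:R * expR (g * (2 * n)%:R) * (z ^+ n * z ^+ n) * eta =
    eta * expR (g * (2 * n)%:R) * (expR (8 * n)%:R * (z ^+ n * z ^+ n))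
      by ring.
rewrite ler_wpM2l ?mulr_ge0 ?expR_ge0//; apply: ler_pM => //.
by rewrite mulr_ge0//; lra.
Qed.

End Constants.

(** * The weight sequence *)

Section Weight.
Variables (R : realType) (A : R -> R).
Hypothesis A_gt0 : forall s, 1 <= s -> 0 < A s.
Hypothesis A_nd : forall s t, 1 <= s -> s <= t -> A s <= A t.
Local Notation e := (expR 1 : R).

Lemma M_gt0 j : 0 < M A j.
Proof. by elim: j => [//|j IH] /=; rewrite mulr_gt0// A_gt0// ler1n. Qed.

Lemma M_upper N j m : (j + m <= N)%N -> (0 < N)%N ->
  M A (j + m) <= M A j * A N%:R ^+ m.
Proof.
move=> + N0; elim: m => [|m IH] jm; first by rewrite addn0 mulr1.
rewrite addnS /= in jm *; rewrite exprSr mulrA.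
apply: ler_pM; first exact/ltW/M_gt0.
- by rewrite ltW// A_gt0// ler1n.
- exact/IH/ltnW.
- by rewrite A_nd ?ler1n// ler_nat.
Qed.

(** Write M_(n+1) <= M_(j+1) A(2n)^(n-j) and replace each factor s A(2n) by n;
    this leaves n^(n+1) / (n+1)! <= e^n. *)
Lemma remainder_le_weight n j (s : R) : (0 < n)%N -> (j <= n)%N -> 0 <= s ->
  s * A (2 * n)%:R <= n%:R ->
  M A n.+1 * (s ^+ n.+1 / (n.+1)`!%:R) <=
  M A j.+1 / A (2 * n)%:R * (s / n%:R) ^+ j * expR n%:R.
Proof.
move=> n0 jn s0 sA.
have nR : 0 < n%:R :> R by rewrite ltr0n.
have f0 : 0 < (n.+1)`!%:R :> R by rewrite ltr0n fact_gt0.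
have A2n : 0 < A (2 * n)%:R by rewrite A_gt0// ler1n muln_gt0.
have M0 := M_gt0.
have Mle : M A n.+1 <= M A j.+1 * A (2 * n)%:R ^+ (n - j).
  by have := @M_upper (2 * n) j.+1 (n - j); rewrite addSn subnKC//; apply; lia.
have c0 : 0 <= M A j.+1 / A (2 * n)%:R * (s / n%:R) ^+ j.
  by rewrite mulr_ge0 ?exprn_ge0 ?divr_ge0 ?(ltW (M0 _)) ?(ltW A2n).
apply: le_trans (ler_wpM2l c0 (expX_fact_le n.+1 (ler0n R n))).
rewrite !mulrA ler_pM2r ?invr_gt0//.
apply: le_trans (ler_wpM2r (exprn_ge0 _ s0) Mle) _.
have nE : n.+1 = (j + (n - j).+1)%N by rewrite addnS subnKC.
rewrite nE !exprD.
have -> : M A j.+1 * A (2 * n)%:R ^+ (n - j) * (s ^+ j * s ^+ (n - j).+1) =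
    M A j.+1 / A (2 * n)%:R * s ^+ j * (s * A (2 * n)%:R) ^+ (n - j).+1.
  by rewrite exprMn [A _ ^+ _.+1]exprS; field; lra.
have -> : M A j.+1 / A (2 * n)%:R * (s / n%:R) ^+ j *
      (n%:R ^+ j * n%:R ^+ (n - j).+1) =
    M A j.+1 / A (2 * n)%:R * s ^+ j * n%:R ^+ (n - j).+1.
  have nj : n%:R ^+ j != 0 :> R by rewrite expf_neq0// gt_eqF.
  by rewrite expr_div_n; field; rewrite nj gt_eqF.
apply: ler_wpM2l.
  by rewrite mulr_ge0 ?exprn_ge0// divr_ge0// ltW// M0.
by rewrite lerXn2r ?nnegrE ?(ltW nR)// mulr_ge0// ltW.
Qed.

Section GrowthIndex.
Hypothesis A_C1 : C1_on `[1, +oo[ A.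

(** The supremum defining gamma is over a bounded set because A' is continuous
    on the compact interval [1, N]. *)
Lemma gamma_ub (N s : R) : 1 <= s <= N ->
  s * derive_on `[1, +oo[ A s / A s <= gamma A N.
Proof.
move=> /andP[s1 sN]; apply: ub_le_sup; last by exists s => //=;
  rewrite in_itv/= s1.
have cA' : {within `[1, N], continuous (derive_on `[1, +oo[ A)}.
  case: A_C1 => _; apply: continuous_subspaceW => x/=; rewrite !in_itv/=; lra.
have [K KP] := within_continuous_bounded cA'.
exists (N * K / A 1) => _ [t tN <-]; move: tN => /=;
  rewrite in_itv/= => /andP[t1 tN].
have A1 := A_gt0 (lexx 1); have At := A_gt0 t1.
apply: le_trans (ler_norm _) _; rewrite !normrM normfV (gtr0_norm At).
have Kt := KP t; apply: ler_pM => //; first by rewrite invr_ge0 ltW.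
- apply: ler_pM => //; last by apply: Kt; lra.
  by rewrite ger0_norm//; lra.
- by rewrite lef_pV2 ?posrE// A_nd.
Qed.

(** That is, A a / A N >= (a / N)^gamma: the function gamma ln - ln A has a
    nonnegative derivative. *)
Lemma weight_ratio (a N : R) : 1 <= a <= N ->
  expR (- (gamma A N * (ln N - ln a))) * A N <= A a.
Proof.
move=> /andP[a1]; rewrite le_eqVlt => /predU1P[<-|aN].
  by rewrite subrr mulr0 oppr0 expR0 mul1r.
pose g s : R := gamma A N * ln s - ln (A s).
have dA (c : R) : 1 < c -> is_derive c 1 A (derive_on `[1, +oo[ A c).
  move=> c1; case: A_C1 => dA _; apply: is_derive_interior => //.
    by rewrite /= in_itv/= andbT ltW.
  apply: (@filterS _ _ _ `]1, +oo[); first by move=> y /=; rewrite !in_itv/=;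
    lra.
  by apply: open_nbhs_nbhs; split=> //=; rewrite in_itv/= andbT.
have dg (c : R) : c \in `]a, N[%R ->
    is_derive c 1 g (gamma A N * c^-1 - (A c)^-1 * derive_on `[1, +oo[ A c).
  rewrite in_itv/= => /andP[ac cN].
  have c1 : 1 < c by lra.
  have := dA c c1 => ?.
  have ? : is_derive c 1 (@ln R) c^-1 by apply: is_derive1_ln; lra.
  have ? : is_derive (A c) 1 (@ln R) (A c)^-1 by apply/is_derive1_ln/A_gt0/ltW.
  have ? := is_derive1_comp (f := @ln R) (g := A) (x := c).
  by apply: is_derive_eq; rewrite /GRing.scale/=.
have cg : {within `[a, N], continuous g}.
  have cA : {within `[a, N], continuous A}.
    have : {within `[1, +oo[, continuous A}.
      by apply: derivable_on_continuous; case: A_C1.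
    by apply: continuous_subspaceW => x/=; rewrite !in_itv/=; lra.
  apply/subspace_continuousP => x /= xaN; rewrite in_itv/= in xaN.
  apply: cvgB.
    apply: cvgMl_tmp.
    by apply: cvg_within_filter; apply: continuous_ln; lra.
  apply: continuous_cvg; first by apply/continuous_ln/A_gt0; lra.
  by move/subspace_continuousP: cA => /(_ x); apply; rewrite /= in_itv.
have [c caN gE] := MVT aN dg cg.
move: caN; rewrite in_itv/= => /andP[ac cN].
have c1 : 1 < c by lra.
have Ac := A_gt0 (ltW c1).
have g_le : g a <= g N.
  rewrite -subr_ge0 gE; apply: mulr_ge0; last by rewrite subr_ge0 ltW.
  rewrite -(pmulr_rge0 _ (lt_trans ltr01 c1)).
  have -> : c * (gamma A N / c - (A c)^-1 * derive_on `[1, +oo[ A c) =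
      gamma A N - c * derive_on `[1, +oo[ A c / A c by field; lra.
  by rewrite subr_ge0; apply: gamma_ub; lra.
have AN : 0 < A N by apply: A_gt0; lra.
have Aa : 0 < A a by apply: A_gt0.
rewrite -[A N]lnK ?posrE// -[A a in X in _ <= X]lnK ?posrE//.
rewrite -expRD ler_expR; move: g_le; rewrite /g; lra.
Qed.

Lemma gamma_ge0 (N : R) : 1 < N -> 0 <= gamma A N.
Proof.
move=> N1; have := @weight_ratio 1 N;
  rewrite lexx (ltW N1) ln1 subr0 => /(_ isT) H.
have A1 := A_gt0 (lexx 1); have A1N := A_nd (lexx 1) (ltW N1).
have lN : 0 < ln N by rewrite ln_gt0.
rewrite -(pmulr_lge0 _ lN) -oppr_le0 -ler_expR expR0.
rewrite -(ler_pM2r (lt_le_trans A1 A1N)) mul1r; exact: le_trans H A1N.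
Qed.

(** Multiplying [weight_ratio] over the first m integers gives the factor
    (N^m / m!)^-gamma, and N^m / m! <= e^N. *)
Lemma M_lower N m : (1 < N)%N -> (m <= N)%N ->
  expR (- (gamma A N%:R * N%:R)) * A N%:R ^+ m <= M A m.
Proof.
move=> N1 mN.
have N0 : 0 < N%:R :> R by rewrite ltr0n ltnW.
have AN : 0 < A N%:R by rewrite A_gt0// ler1n ltnW.
have f0 k : 0 < k`!%:R :> R by rewrite ltr0n fact_gt0.
have l0 k : 0 < N%:R ^+ k / k`!%:R :> R by rewrite divr_gt0// exprn_gt0.
have g0 : 0 <= gamma A N%:R by rewrite gamma_ge0// ltr1n.
suff H : expR (- (gamma A N%:R * ln (N%:R ^+ m / m`!%:R))) * A N%:R ^+ m <=
  M A m.
  apply: le_trans H; rewrite ler_pM2r ?exprn_gt0// ler_expR lerN2 ler_wpM2l//.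
  by rewrite -ler_expR lnK ?posrE// expX_fact_le// ltW.
elim: m mN => [|m IH] mN.
  by rewrite fact0 expr0 divr1 ln1 mulr0 oppr0 expR0 mulr1.
have mR : 0 < m.+1%:R :> R by rewrite ltr0n.
have -> : ln (N%:R ^+ m.+1 / (m.+1)`!%:R) =
    ln (N%:R ^+ m / m`!%:R) + (ln N%:R - ln m.+1%:R) :> R.
  have l1 : 0 < N%:R / m.+1%:R :> R by rewrite divr_gt0.
  have lm := l0 m.
  rewrite -(ln_div N0 mR) -(lnM lm l1); congr ln.
  rewrite factS natrM exprSr; have := f0 m; move: mR => ? ?; field; lra.
rewrite mulrDr opprD expRD exprSr [leRHS]/=.
have := @weight_ratio m.+1%:R N%:R; rewrite ler1n ler_nat mN => /(_ isT) H.
rewrite mulrACA; apply: ler_pM => //;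
  rewrite ?mulr_ge0 ?expR_ge0 ?exprn_ge0 ?(ltW AN)//.
exact: IH (ltnW mN).
Qed.

(** Here (s/n)^j >= A(2n)^-j, so that [M_lower] with N = 2n and m = j + 1
    applies. *)
Lemma weight_ge n j (s : R) : (0 < n)%N -> (j <= n)%N ->
  n%:R <= s * A (2 * n)%:R ->
  expR (- (gamma A (2 * n)%:R * (2 * n)%:R)) <=
  M A j.+1 / A (2 * n)%:R * (s / n%:R) ^+ j.
Proof.
move=> n0 jn sA.
have nR : 0 < n%:R :> R by rewrite ltr0n.
have A2n : 0 < A (2 * n)%:R by rewrite A_gt0// ler1n muln_gt0.
have M0 := M_gt0.
have := @M_lower (2 * n) j.+1.
have -> : (1 < 2 * n)%N by lia.
have -> : (j < 2 * n)%N by lia.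
move=> /(_ isT isT); rewrite -ler_pdivlMr ?exprn_gt0// => /le_trans; apply.
rewrite exprS invfM mulrA ler_wpM2l ?divr_ge0 ?(ltW (M0 _)) ?(ltW A2n)//.
rewrite -exprVn lerXn2r ?nnegrE ?invr_ge0 ?(ltW A2n)//.
  rewrite divr_ge0 ?(ltW nR)//.
  by rewrite -(pmulr_lge0 _ A2n) (le_trans _ sA)// ltW.
by rewrite ler_pdivlMr// mulrC ler_pdivrMr.
Qed.

End GrowthIndex.

(** * Bang degree and smallness on a set *)

(** If interpolation of F 0 at nodes to the left of X produces derivatives that
    are all tiny, then F 0 X is small.  This is [bang_propagation] with weights
    A(max(i, k+1)): the first k of them are equal to A(k+1) and account for the
    factor e^-k.  Indices above n+1 are cut off in order that only values of A
    on [1, 2n] occur. *)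
Lemma small_interpolant_right (F : nat -> R -> R) (n k : nat) (x : nat -> R)
    (delta X eta s : R) :
  deriv_chain 0 1 F -> (forall j t, 0 <= t <= 1 -> `|F j t| <= M A j) ->
  (0 < n)%N -> (k <= n)%N -> e <= \sum_(k.+1 <= i < n.+2) (A i%:R)^-1 ->
  0 < delta -> (forall i, (i < n)%N -> x i + delta <= x i.+1) ->
  0 <= x 0%N -> x n <= X -> X <= 1 -> x n - x 0%N <= s ->
  (forall i, (i <= n)%N -> `|F 0%N (x i)| <= eta) ->
  (forall j, (j <= n)%N ->
    eta * (n ^_ j)%:R * s ^+ (n - j) * (2 ^+ n / (n`!%:R * delta ^+ n)) <=
    expR (- (n + 4)%:R) * (M A j.+1 / A (2 * n)%:R)) ->
  `|F 0%N X| <= expR (- k.+1%:R).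
Proof.
move=> FP FM n0 kn sumA d0 gap x0 xX X1 xs Fx small.
have e0 : 0 < e := expR_gt0 1.
pose P := interp n x (fun i => F 0%N (x i)).
have x_le i j : (i <= j <= n)%N -> x i <= x j.
  move=> ij; rewrite -subr_ge0; apply: le_trans (node_gap gap ij).
  by rewrite mulr_ge0// ltW.
have [||||xi [xi_dec xi0 xin Fxi]] := rolle_chain (m := n) (z := x)
    (deriv_chain_subpoly P FP).
- by move=> i im; have := gap i im; lra.
- by [].
- by lra.
- move=> i im; rewrite derivn0.
  by rewrite (interpE (fun i =>
    F 0%N (x i)) d0 gap (Ordinal (im : (i < n.+1)%N))) subrr.
have xi_ge j : (j <= n)%N -> xi n <= xi j.
  by move=> jn; apply: (nonincreasing_upto xi_dec); rewrite jn leqnn.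
have xi_le j : (j <= n)%N -> xi j <= xi 0%N.
  by move=> jn; apply: (nonincreasing_upto xi_dec).
pose idx i := minn (maxn i k.+1) n.+1.
pose b i : R := A (idx i)%:R.
have idx1 i : (0 < idx i)%N by rewrite /idx leq_min leq_max orbT.
have b_gt0 i : 0 < b i by rewrite A_gt0// ler1n.
have idx_nd i j : (i <= j)%N -> (idx i <= idx j)%N.
  by move=> ij; rewrite /idx leq_min geq_minr andbT geq_min geq_max !leq_max
    ij leqnn orbT.
have b_nd i : b i <= b i.+1 by rewrite A_nd ?ler1n// ler_nat idx_nd.
have A_b i : (0 < i <= n.+1)%N -> A i%:R <= b i.
  move=> /andP[i0 im]; rewrite A_nd ?ler1n// ler_nat /idx leq_min im andbT.
  by rewrite leq_max leqnn.
have M0 := M_gt0.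
have A2n : 0 < A (2 * n)%:R by rewrite A_gt0// ler1n muln_gt0.
pose G j t := F j t / M A j; pose dG j t := F j.+1 t / M A j.
have := @bang_propagation R n b xi G dG X n0 b_gt0 b_nd xi_dec.
have xi0X : xi 0%N <= X by lra.
have GP j (t : R) : (j <= n)%N -> xi n < t < X -> is_derive t 1 (G j) (dG j t).
  move=> jn tX; have [_ /(_ t)] := FP j; have -> : 0 < t < 1 by lra.
  move=> /(_ isT) ?; apply: is_derive_eq; rewrite /GRing.scale/= /dG; ring.
move=> /(_ GP).
have cG j : (j <= n)%N -> {within `[xi n, X], continuous (G j)}.
  move=> jn; have [cF _] := FP j.
  have {}cF : {within `[xi n, X], continuous (F j)}.
    by apply: continuous_subspaceW cF => u/=; rewrite !in_itv/=; lra.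
  apply/subspace_continuousP => t tX; apply: cvgMr_tmp.
  by move/subspace_continuousP: cF; exact.
move=> /(_ cG).
have dG_le j t : (j <= n)%N -> xi n < t < X ->
  `|dG j t| <= b j.+1 * `|G j.+1 t|.
  move=> jn tX; rewrite /dG /G !normrM !normfV !(gtr0_norm (M0 _)) [M A
    j.+1]/=.
  have Aj : 0 < A j.+1%:R by rewrite A_gt0// ler1n.
  have -> : `|F j.+1 t| / M A j =
    A j.+1%:R * (`|F j.+1 t| / (M A j * A j.+1%:R)).
    by have := M0 j => ?; field; lra.
  rewrite ler_wpM2r// ?A_b// divr_ge0// ltW// mulr_gt0//.
move=> /(_ dG_le).
have G_le1 j t : (j <= n.+1)%N -> xi n <= t <= X -> `|G j t| <= 1.
  move=> _ tX; rewrite /G normrM normfV (gtr0_norm (M0 _)) ler_pdivrMr// mul1r.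
  by apply: FM; lra.
move=> /(_ G_le1).
have G_xi j : (j <= n)%N -> `|G j (xi j)| <=
  expR (- (n + 4)%:R) * (b j.+1 / b j.+2).
  move=> jn; have /eqP := Fxi j jn; rewrite subr_eq0 => /eqP FE.
  rewrite /G FE normrM normfV (gtr0_norm (M0 _)) ler_pdivrMr//.
  apply: (@le_trans _ _ (expR (- (n + 4)%:R) * (M A j.+1 / A (2 * n)%:R))).
    apply: le_trans (small j jn); apply: interp_deriv_le => //.
    move=> i im; have := x_le 0%N i; have := x_le i n;
      rewrite im leqnn /= => /(_ isT) ? /(_ isT) ?.
    by have := xi_ge j jn; have := xi_le j jn; rewrite ler_norml; lra.
  rewrite -[leRHS]mulrA ler_pM2l ?expR_gt0//.
  have -> : M A j.+1 / A (2 * n)%:R = A j.+1%:R / A (2 * n)%:R * M A j.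
    by rewrite /=; ring.
  rewrite ler_pM2r//.
  apply: ler_pM; rewrite ?invr_ge0 ?(ltW A2n) ?A_b//.
    by rewrite ltW// A_gt0// ler1n.
  rewrite lef_pV2 ?posrE// A_nd ?ler1n// ler_nat /idx geq_min; apply/orP;
    right.
  by rewrite mul2n -addnn -addn1 leq_add2l.
move=> /(_ G_xi 0%N n0 X); rewrite xi0X lexx => /(_ isT).
have -> : `|G 0%N X| = `|F 0%N X| by rewrite /G /= divr1.
move=> /le_trans; apply; rewrite ler_expR.
have b1E : b 1%N = A k.+1%:R by rewrite /b /idx (maxn_idPr _)// (minn_idPl _).
have eb1 : 0 < e * b 1%N by rewrite mulr_gt0.
have -> : e * b 1%N * (X - bang_time n b xi 2) - 2 =
  e * b 1%N * (X - bang_time n b xi 1) - 1.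
  rewrite (@bang_timeE R n b xi 1)//; have := b_gt0 1%N => ?; field; lra.
have sumb : k%:R + e * b 1%N <= e * b 1%N * (bang_time n b xi 1 - xi n).
  rewrite /bang_time [_ - xi n]addrAC subrr add0r.
  rewrite (@big_cat_nat _ _ _ k.+1)//= ?ltnS ?leqW// mulrDr lerD//.
    have -> : k%:R = \sum_(1 <= i < k.+1) (1 : R)
      by rewrite sumr_const_nat subn1.
    rewrite big_distrr/=; apply: ler_sum_nat => i /andP[i1 ik].
    have -> : b i = b 1%N by rewrite b1E /b /idx (maxn_idPr _) ?(minn_idPl _)
      // ltnW.
    by rewrite divff// gt_eqF.
  have -> : \sum_(k.+1 <= i < n.+2) (e * b i)^-1
      = e^-1 * \sum_(k.+1 <= i < n.+2) (A i%:R)^-1.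
    rewrite big_distrr/=; apply: eq_big_nat => i /andP[ki im].
    by rewrite invfM /b /idx (maxn_idPl _)// (minn_idPl _).
  by rewrite mulrA [e * b 1%N]mulrC mulfK ?gt_eqF// ler_pM2l.
have : e * b 1%N * (X - xi n) <= e * b 1%N * 1 by rewrite ler_pM2l//; lra.
rewrite -natr1; lra.
Qed.

(** One side of X contains half of E; if it is the right one, reflect.  All the
    interpolated derivatives being tiny would contradict the size of F 0 X. *)
Lemma set_norm_lower_bound (F : nat -> R -> R) (n k : nat) (E : set R)
    (X eta s : R) :
  deriv_chain 0 1 F -> (forall j t, 0 <= t <= 1 -> `|F j t| <= M A j) ->
  (0 < n)%N -> (k <= n)%N -> e <= \sum_(k.+1 <= i < n.+2) (A i%:R)^-1 ->
  0 <= X <= 1 -> expR (- k.+1%:R) < `|F 0%N X| ->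
  E `<=` `[0, 1] -> 0 < length E -> length E <= s ->
  (forall x y, E x -> E y -> y - x <= s) ->
  (forall x, E x -> `|F 0%N x| <= eta) ->
  exists2 j, (j <= n)%N &
    M A j.+1 / A (2 * n)%:R * (s / n%:R) ^+ j <=
    eta * expR (2 * n + 5)%:R * (4 * s / length E) ^+ n.
Proof.
move=> FP FM n0 kn sumA X01 FX E01 l0 ls diam FE.
apply: contrapT => /forall2NP H.
have {}H j : (j <= n)%N -> eta * expR (2 * n + 5)%:R * (4 * s / length E) ^+ n
    <= M A j.+1 / A (2 * n)%:R * (s / n%:R) ^+ j.
  by move=> jn; have [//|/negP] := H j; rewrite -ltNge => /ltW.
have [x0 Ex0] : E !=set0.
  by apply/set0P/eqP => E0; move: l0; rewrite E0 length0 ltxx.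
have eta0 : 0 <= eta by apply: le_trans (FE x0 Ex0).
set l := length E in l0 ls H.
pose delta := l / (2 * n.+1%:R).
have nR : 0 < n%:R :> R by rewrite ltr0n.
have d0 : 0 < delta by rewrite divr_gt0// mulr_gt0.
(* n gaps of length delta fit into a set of length l / 2 *)
have dn : n%:R * delta < l / 2.
  have -> : n%:R * delta = l / 2 * (n%:R / n.+1%:R).
    by rewrite /delta; move: (n.+1%:R : R) (ltr0Sn R n) => u u0; field; lra.
  by rewrite gtr_pMr ?divr_gt0// ltr_pdivrMr// mul1r ltr_nat.
have num j (jn : (j <= n)%N) :=
  interp_deriv_const_le n0 jn eta0 l0 ls (H j jn).
pose E1 := E `&` `[0, X]; pose E2 := E `&` `[X, 1].
have EU : E `<=` E1 `|` E2.
  move=> x Ex; have := E01 x Ex; rewrite /E1 /E2 /= !in_itv/= => x01.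
  by have [xX|Xx] := leP x X; [left|right]; split=> //; lra.
have UE : E1 `|` E2 `<=` `[0, 1] by move=> x [[/E01]|[/E01]].
have : l <= length E1 + length E2.
  by apply: le_trans (le_length EU UE) (length_setU_le UE).
have [lE1 _|lE1 lE2] := ltP (n%:R * delta) (length E1).
  have E1_01 := subset_trans (@subsetUl _ _ _) UE.
  have [x [xE1 gap]] := separated_points (ltW d0) E1_01 lE1.
  have xE i (im : (i <= n)%N) : E (x i) by case: (xE1 i im).
  have := @small_interpolant_right F n k x delta X eta s FP FM n0 kn sumA d0
    gap.
  have [_ /=] := xE1 0%N isT; have [_ /=] := xE1 n (leqnn n);
    rewrite !in_itv/= => xn x00.
  have -> : 0 <= x 0%N by lra.
  have -> : x n <= X by lra.
  have -> : X <= 1 by lra.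
  have -> : x n - x 0%N <= s by apply: diam; exact: xE.
  move=> /(_ isT isT isT isT) K.
  have : `|F 0%N X| <= expR (- k.+1%:R).
    by apply: K => // i im; exact/FE/xE.
  lra.
have {lE1}lE2 : n%:R * delta < length E2 by lra.
have E2_01 := subset_trans (@subsetUr _ _ _) UE.
have [x [xE2 gap]] := separated_points (ltW d0) E2_01 lE2.
have xE i (im : (i <= n)%N) : E (x i) by case: (xE2 i im).
have FM' j t : 0 <= t <= 1 -> `|(-1) ^+ j * F j (1 - t)| <= M A j.
  by move=> t01; rewrite normrM normrX normrN1 expr1n mul1r; apply: FM; lra.
have := @small_interpolant_right _ n k (fun i => 1 - x (n - i)%N)
  delta (1 - X) eta s (deriv_chain_reflect FP) FM' n0 kn sumA d0.
rewrite /= subn0 subnn.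
have [_ /=] := xE2 0%N isT; have [_ /=] := xE2 n (leqnn n);
  rewrite !in_itv/= => xn x00.
have -> : 0 <= 1 - x n by lra.
have -> : 1 - x 0%N <= 1 - X by lra.
have -> : 1 - X <= 1 by lra.
have -> : 1 - x 0%N - (1 - x n) <= s.
  by have := diam _ _ (xE 0%N isT) (xE n (leqnn n)); lra.
move=> /(_ _ isT isT isT isT) K.
have : `|F 0%N X| <= expR (- k.+1%:R).
  rewrite -[X in F _ X](subKr 1) -[F _ _]mul1r -[1 in X in X * _](expr0 (-1)).
  apply: K => // i im; last by rewrite expr0 mul1r subKr; apply/FE/xE;
    exact: leq_subr.
  by have := gap (n - i.+1)%N; rewrite subnSK// leq_subr => /(_ isT); lra.
lra.
Qed.

Lemma class_C_bounded (f : R -> R) : class_C A f ->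
  forall j t, 0 <= t <= 1 ->
  `|deriven_on `[0, 1] j f t| <= supnorm `[0, 1] (deriven_on `[0, 1] j f) <=
    M A j.
Proof.
move=> [fs fM] j t t01; rewrite fM andbT.
have [cf _] := smooth_on_chain fs j.
have [K KP] := within_continuous_bounded cf.
apply: (ler_supnorm (B := K)) => [y|]; rewrite /= in_itv//=; exact: KP.
Qed.

(** Here k is the integer part of log (1 / |f|), and the sum in the definition
    of the Bang degree starts at k + 1.  It cannot be empty for N = n + 1, which
    gives k <= n, and f is not 0 since otherwise all the sums would be empty. *)
Lemma bang_degree_levels (f : R -> R) (n : nat) : class_C A f ->
  bang_degree A f = n%:R%:E ->
  exists2 k : nat, (k <= n)%N /\ e <= \sum_(k.+1 <= i < n.+2) (A i%:R)^-1 &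
    exists2 X, 0 <= X <= 1 & expR (- k.+1%:R) < `|f X|.
Proof.
move=> fC bang_f; have e0 : 0 < e := expR_gt0 1.
have sum_ge : e <= bang_sum A f n.+1.
  rewrite leNgt; apply/negP => H.
  have : ((n.+1)%:R%:E <= bang_degree A f)%E by apply: ereal_sup_ubound;
    exists n.+1.
  by rewrite bang_f lee_fin ler_nat ltnn.
set v := supnorm `[0, 1] f in sum_ge *.
have fv t : 0 <= t <= 1 -> `|f t| <= v
  by move=> /(class_C_bounded fC 0%N)/andP[].
have v1 : v <= 1 by case: fC => _ /(_ 0%N).
have v0 : 0 < v.
  have : 0 <= v by apply: le_trans (fv 0 _); rewrite ?lexx ?ler01.
  rewrite le_eqVlt => /predU1P[v0|//].
  move: sum_ge; rewrite /bang_sum -/v -v0 inver eqxx big1_seq ?leNgt ?e0// =>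
    j /andP[].
pose L := - ln v.
have L0 : 0 <= L by rewrite oppr_ge0 ln_le0.
pose k := Num.truncn L.
have sumE : bang_sum A f n.+1 = \sum_(1 <= i < n.+2 | (k < i)%N) (A i%:R)^-1.
  rewrite /bang_sum -/v inver gt_eqF// lne_EFin ?invr_gt0// lnV ?posrE// -/L.
  rewrite big_nat_cond [RHS]big_nat_cond; apply: eq_big => i.
    by rewrite lte_fin truncn_lt_nat.
  move=> /andP[/andP[]]; case: i => [//|i] _ _ _ /=.
  have M0 := M_gt0 i.
  have Ai : 0 < A i.+1%:R by rewrite A_gt0// ler1n.
  by rewrite invfM mulrA divff ?mul1r ?gt_eqF.
have kn : (k <= n)%N.
  rewrite leqNgt; apply/negP => nk.
  move: sum_ge; rewrite sumE big_nat_cond big_pred0 ?leNgt ?e0// => i.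
  apply/negP => /andP[/andP[_ im] ki].
  by have := leq_ltn_trans (leq_ltn_trans nk ki) im; rewrite ltnn.
exists k; [split=> //|].
  move: sum_ge; rewrite sumE (@big_cat_nat _ _ _ k.+1)//=;
    last by rewrite ltnS leqW.
  rewrite big_nat_cond big_pred0 ?add0r => [|i]; last first.
    by apply/negP => /andP[/andP[_]]; rewrite ltnS leqNgt => /negP.
  move=> /le_trans; apply; rewrite big_nat_cond [leRHS]big_nat_cond.
  rewrite le_eqVlt; apply/orP; left; apply/eqP; apply: eq_bigl => i.
  by rewrite andbAC andbb andbT.
have ev : expR (- k.+1%:R) < v.
  rewrite -[v]lnK ?posrE// ltr_expR ltrNl; exact: truncnS_gt.
have [|_ [X X01 <-] lt] := sup_gt _ ev.
  by exists `|f 0|, 0 => //=; rewrite in_itv/= lexx ler01.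
by exists X => //; move: X01; rewrite /= in_itv.
Qed.

End Weight.

(** * The Remez-type inequality *)

Theorem theoremB (R : realType) (A : R -> R)
  (A_gt0 : forall s, 1 <= s -> 0 < A s)
  (A_nd : forall s t, 1 <= s -> s <= t -> A s <= A t)
  (A_C1 : C1_on `[1, +oo[ A)
  (f : R -> R) (fC : class_C A f)
  (n : nat) (n_gt0 : (0 < n)%N) (bang_f : bang_degree A f = (n%:R)%:E)
  (I : interval R) (I01 : [set` I] `<=` `[0, 1])
  (E : set R) (EI : E `<=` [set` I])
  (mE : lebesgue_measurable E) (E_gt0 : 0 < length E) :
  supnorm [set` I] f <=
    (Gamma A (2 * n)%:R * length [set` I] / length E) ^+ (2 * n)
    * supnorm E f.
Proof.
have [k [kn sumA] [X X01 fX]] := bang_degree_levels A_gt0 fC bang_f.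
pose F j := deriven_on `[0, 1] j f.
have FP : deriv_chain 0 1 F by case: fC => + _; exact: smooth_on_chain.
have FM j t : 0 <= t <= 1 -> `|F j t| <= M A j.
  by move=> /(class_C_bounded fC j)/andP[]; exact: le_trans.
have E01 : E `<=` `[0, 1] by exact: subset_trans I01.
pose s := length [set` I]; pose l := length E; pose eta := supnorm E f.
have ls : l <= s := le_length EI I01.
have s0 : 0 < s by apply: lt_le_trans ls.
have Idiam x y : [set` I] x -> [set` I] y -> y - x <= s.
  move=> Ix Iy; have [xy|yx] := leP x y; last by lra.
  rewrite -length_itv//; apply: (le_length _ I01) => z;
    rewrite /= in_itv/= => xzy.
  exact: (interval_is_interval Ix Iy).
have E0 x : E x -> `|f x| <= eta.
  move=> Ex; apply: (ler_supnorm (B := M A 0)) => // y /E01;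
    rewrite /= in_itv/=.
  exact: FM 0%N y.
have [x0 Ex0] : E !=set0.
  by apply/set0P/eqP => E0'; move: E_gt0; rewrite E0' length0 ltxx.
have eta0 : 0 <= eta by apply: le_trans (E0 x0 Ex0).
have [j jn key] := set_norm_lower_bound A_gt0 A_nd FP FM n_gt0 kn sumA X01 fX
  E01 E_gt0 ls
  (fun x y Ex Ey => Idiam x y (EI x Ex) (EI y Ey)) E0.
have g0 : 0 <= gamma A (2 * n)%:R.
  by apply: gamma_ge0 => //; rewrite ltr1n mul2n -addnn -addn1 leq_add.
(* the factor 2 is for the two terms of the second case below *)
have target m : (m <= 8 * n)%N -> 2 * (expR (gamma A (2 * n)%:R * (2 * n)%:R) *
    (eta * expR m%:R * (4 * s / l) ^+ n)) <=
    (Gamma A (2 * n)%:R * s / l) ^+ (2 * n) * eta.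
  by move=> mn; apply: Gamma_power_ge.
apply: ge_sup; first by exists `|f x0|, x0 => //; exact: EI.
move=> _ [y Iy <-].
have y01 : 0 <= y <= 1 by have := I01 _ Iy; rewrite /= in_itv.
have Zm m : 0 <= eta * expR m%:R * (4 * s / l) ^+ n.
  by rewrite !mulr_ge0 ?expR_ge0// exprn_ge0// divr_ge0 ?(ltW E_gt0)//
    mulr_ge0// ltW.
have [sA|sA] := leP n%:R (s * A (2 * n)%:R).
  (* I is so long that the lower bound for eta is not small; use |f| <= 1 *)
  apply: le_trans (FM 0%N y y01) _; rewrite [M A 0]/=.
  have K := le_trans (weight_ge A_gt0 A_nd A_C1 n_gt0 jn sA) key.
  have m8 : (2 * n + 5 <= 8 * n)%N by clear -n_gt0; lia.
  apply: le_trans (target _ m8); have := Zm (2 * n + 5)%N.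
  have := expR_gt0 (gamma A (2 * n)%:R * (2 * n)%:R).
  move: K; rewrite expRN.
  move: (eta * _ * _) (expR (_ * _)) => c u K u0 c0.
  have : 1 <= u * c by rewrite -ler_pdivrMl// mulr1.
  lra.
(* I is short: f is close to an interpolant, at any separated nodes of E *)
pose delta := l / (2 * n.+1%:R).
have d0 : 0 < delta by rewrite divr_gt0// mulr_gt0.
have dn : n%:R * delta < l.
  have -> : n%:R * delta = l * (n%:R / (2 * n.+1%:R)) by rewrite /delta; ring.
  rewrite gtr_pMr// ltr_pdivrMr ?mulr_gt0// mul1r -natrM ltr_nat.
  by rewrite mul2n -addnn ltn_addr.
have [x [xE gap]] := separated_points (ltW d0) E01 dn.
have xI i : (i <= n)%N -> `|y - x i| <= s.
  move=> im; have Ix := EI _ (xE i im).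
  by have := Idiam _ _ Ix Iy; have := Idiam _ _ Iy Ix; rewrite ler_norml; lra.
have x01 i : (i <= n)%N -> 0 <= x i <= 1.
  by move=> im; have := E01 _ (xE i im); rewrite /= in_itv.
have rem := interp_remainder FP d0 gap x01 y01 (FM n.+1) xI.
have Ex i (im : (i <= n)%N) : `|F 0%N (x i)| <= eta by exact/E0/xE.
have := interp_deriv_le d0 gap 0 Ex xI.
set P := interp _ _ _ in rem *; rewrite derivn0 => Py.
set c := eta * expR (2 * n + 5)%:R * (4 * s / l) ^+ n in key.
have PW : `|P.[y]| <= expR (- (n + 4)%:R) * c.
  apply: le_trans Py _; apply: interp_deriv_const_le => //.
  by rewrite expr0 mulr1.
have remW : M A n.+1 * (s ^+ n.+1 / (n.+1)`!%:R) <= c * expR n%:R.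
  apply: le_trans (remainder_le_weight A_gt0 A_nd n_gt0 jn (ltW s0) (ltW sA))
    _.
  by rewrite ler_wpM2r ?expR_ge0.
have m8 : (3 * n + 5 <= 8 * n)%N by clear -n_gt0; lia.
apply: le_trans (target _ m8).
have fy : `|f y| <= expR (- (n + 4)%:R) * c + c * expR n%:R.
  have := ler_normD (F 0%N y - P.[y]) P.[y]; rewrite subrK [F 0%N y]/=; lra.
apply: le_trans fy _.
have c0 : 0 <= c := Zm _.
have -> : eta * expR (3 * n + 5)%:R * (4 * s / l) ^+ n = c * expR n%:R.
  have -> : (3 * n + 5)%:R = (2 * n + 5)%:R + n%:R :> R.
    by rewrite -natrD; congr (_%:R); clear; lia.
  by rewrite expRD /c; ring.
have n1 : 1 <= expR n%:R :> R by rewrite -expR0 ler_expR.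
have n4 : expR (- (n + 4)%:R) <= 1 :> R by rewrite -expR0 ler_expR oppr_le0.
have g1 : 1 <= expR (gamma A (2 * n)%:R * (2 * n)%:R).
  by rewrite -[leLHS]expR0 ler_expR mulr_ge0.
have h1 : expR (- (n + 4)%:R) * c <= c * expR n%:R.
  by rewrite mulrC ler_wpM2l// (le_trans n4).
have h2 : c * expR n%:R <=
    expR (gamma A (2 * n)%:R * (2 * n)%:R) * (c * expR n%:R).
  by rewrite ler_peMl// mulr_ge0// expR_ge0.
lra.
Qed.
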